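(* Let $\Delta$ be a set of continuous derivations of $\mathcal{A}$ and let $\mathcal{C}=\ker_{\mathcal{F}}\Delta$. Let $f_1,\dots,f_n\in\mathcal{A}$ be such that either (1) $\operatorname{Exp}(f_1),\dots,\operatorname{Exp}(f_n)$ are multiplicatively independent modulo $\mathcal{C}^{\times}$; or (2) $f_1,\dots,f_n$ are $\mathbb{Q}$-linearly independent modulo $\mathcal{C}$. Then $$\operatorname{tr.deg}_{\mathcal{C}}\ \mathcal{C}\bigl(f_1,\dots,f_n,\operatorname{Exp}(f_1),\dots,\operatorname{Exp}(f_n)\bigr)\ \ge\ n+\operatorname{rank}_{\mathcal{F}}\,(Df_i)_{D\in\Delta,\ 1\le i\le n}.$$
   Context: $\mathbb{N}=\{1,2,3,\dots\}$. An arithmetic function is a function $f:\mathbb{N}\to\mathbb{C}$. $\mathcal{A}$ is the commutative $\mathbb{C}$-algebra of arithmetic functions under pointwise addition and convolution $(f*g)(n)=\sum_{d\mid n}f(d)g(n/d)$; $\alpha\in\mathbb{C}$ is identified with the function $1\mapsto\alpha$, $n\mapsto 0$ for $n>1$. All products and powers are convolution products. $\mathcal{A}$ is an integral domain; $\mathcal{F}$ is its field of fractions. For $f\ne 0$ the order $v(f)$ is the least $n$ with $f(n)\neq 0$, and $v(0)=\infty$. $\|f\|=1/v(f)$ (with $1/\infty=0$) is a non-archimedean norm on $\mathcal{A}$, giving a metric $\|f-g\|$ and hence a topology on $\mathcal{A}$. A derivation of $\mathcal{A}$ is a $\mathbb{C}$-linear map $D:\mathcal{A}\to\mathcal{A}$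 with $D(f*g)=Df*g+f*Dg$; it is continuous if it is continuous for this topology. $D$ also denotes its unique extension to a derivation of $\mathcal{F}$. For a set $\Delta$ of derivations, $\ker_{\mathcal{F}}\Delta=\{x\in\mathcal{F}: Dx=0 \text{ for all } D\in\Delta\}$ (equal to $\mathcal{F}$ if $\Delta=\emptyset$); it is a subfield of $\mathcal{F}$ containing $\mathbb{C}$. If $f(1)=0$, $\operatorname{Exp}(f)=\sum_{k\ge0}f^k/k!$ (convergent in the topology on $\mathcal{A}$ induced by the norm $\|\cdot\|$); in general $\operatorname{Exp}(f)=\exp(f(1))*\operatorname{Exp}(f-f(1))$, where $\exp$ is the complex exponential. Elements $z_1,\dots,z_n$ of $\mathcal{F}^\times$ are multiplicatively independent modulo the subgroup $\mathcal{C}^\times$ if $z_1^{k_1}\cdots z_n^{k_n}\in\mathcal{C}^\times$ with $k_i\in\mathbb{Z}$ implies all $k_i=0$. $\mathbb{Q}$-linearly independent modulo $\mathcal{C}$ means that the images in the $\mathbb{Q}$-vector space $\mathcal{F}/\mathcal{C}$ are $\mathbb{Q}$-linearly independent. *)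

(* Defs.v *)
From HB Require Import structures.
From mathcomp Require Import all_boot all_order all_algebra.
From mathcomp Require Import complex ring.
(* The notations of [mpoly] clash with those of MathComp-Analysis. *)
From mathcomp Require Import -(notations) mpoly.
From mathcomp Require Import all_classical all_reals.
From mathcomp Require Import ereal topology normedtype sequences exp trigo.

Set Implicit Arguments.
Unset Strict Implicit.
Unset Printing Implicit Defensive.

Import Order.TTheory GRing.Theory Num.Theory.
Local Open Scope classical_set_scope.
Local Open Scope ring_scope.

Section Arith.
Context {R : realType}.

Definition vanish0 : pred (nat -> R[i]) := fun f => f 0%N == 0.

(* Functions on {1, 2, 3, ...} are encoded as functions on [nat] that vanish
   at 0. *)
Record arith := Arith { aval :> nat -> R[i]; _ : vanish0 aval }.

HB.instance Definition _ := [isSub for aval].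
HB.instance Definition _ := gen_eqMixin arith.
HB.instance Definition _ := gen_choiceMixin arith.

Implicit Types f g h : arith.

Lemma arith0 f : f 0%N = 0. Proof. by case: f => f /= /eqP. Qed.

Lemma arithP f g : (forall n, (0 < n)%N -> f n = g n) -> f = g.
Proof.
move=> fg; apply: val_inj; apply/funext => -[|n]; last exact: fg.
by rewrite /= !arith0.
Qed.

Lemma azero_subproof : vanish0 (fun=> 0). Proof. exact/eqP. Qed.
Definition azero := Arith azero_subproof.

Lemma aadd_subproof f g : vanish0 (fun n => f n + g n).
Proof. by rewrite /vanish0 !arith0 addr0. Qed.
Definition aadd f g := Arith (aadd_subproof f g).

Lemma aopp_subproof f : vanish0 (fun n => - f n).
Proof. by rewrite /vanish0 arith0 oppr0. Qed.
Definition aopp f := Arith (aopp_subproof f).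

Lemma ascale_subproof (a : R[i]) f : vanish0 (fun n => a * f n).
Proof. by rewrite /vanish0 arith0 mulr0. Qed.
Definition ascale a f := Arith (ascale_subproof a f).

Lemma aone_subproof : vanish0 (fun n => (n == 1%N)%:R).
Proof. exact/eqP. Qed.
Definition aone := Arith aone_subproof.

Lemma aconv_subproof f g :
  vanish0 (fun n => \sum_(d <- divisors n) f d * g (n %/ d)%N).
Proof. by rewrite /vanish0 big1// => d _; rewrite div0n arith0 mulr0. Qed.
Definition aconv f g := Arith (aconv_subproof f g).

Lemma aaddA : associative aadd.
Proof. by move=> f g h; apply: arithP => n _ /=; rewrite addrA. Qed.
Lemma aaddC : commutative aadd.
Proof. by move=> f g; apply: arithP => n _ /=; rewrite addrC. Qed.
Lemma aadd0 : left_id azero aadd.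
Proof. by move=> f; apply: arithP => n _ /=; rewrite add0r. Qed.
Lemma aaddN : left_inverse azero aopp aadd.
Proof. by move=> f; apply: arithP => n _ /=; rewrite addNr. Qed.

HB.instance Definition _ :=
  GRing.isZmodule.Build arith aaddA aaddC aadd0 aaddN.

Lemma aconvE N f g n : (0 < n < N)%N ->
  aconv f g n = \sum_(i < N) \sum_(j < N) (f i * g j) *+ (i * j == n)%N.
Proof.
move=> /andP[n0 nN] /=.
have /(perm_big _) -> : perm_eq (divisors n) [seq d <- index_iota 0 N | (d %| n)%N].
  apply: uniq_perm; rewrite ?divisors_uniq ?filter_uniq ?iota_uniq// => d.
  rewrite -dvdn_divisors// mem_filter mem_index_iota /=.
  by case: (boolP (d %| n)%N) => //= /(dvdn_leq n0) dn; rewrite (leq_ltn_trans dn).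
rewrite big_filter big_mkcond big_mkord; apply: eq_bigr => i _.
case: ifPn => [/dvdnP[q nq]|ni].
  have i0 : (0 < i)%N by move: n0; rewrite nq muln_gt0 => /andP[].
  have qN : (q < N)%N.
    by apply: leq_ltn_trans nN; rewrite nq leq_pmulr.
  rewrite (bigD1 (Ordinal qN))//= big1 ?addr0 => [|j /eqP jq].
    by rewrite nq mulnK// mulnC eqxx.
  case: eqP => // ijn; case: jq; apply: val_inj => /=.
  by apply/eqP; rewrite -(eqn_pmul2l i0) ijn nq mulnC.
rewrite big1// => j _; case: eqP => // ijn.
by case/negP: ni; rewrite -ijn dvdn_mulr.
Qed.

Lemma aconvC : commutative aconv.
Proof.
move=> f g; apply: arithP => n n0.
have nn : (0 < n < n.+1)%N by rewrite n0 ltnS leqnn.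
rewrite !(aconvE _ _ nn).
rewrite exchange_big; apply: eq_bigr => i _; apply: eq_bigr => j _.
by rewrite mulrC mulnC.
Qed.

Lemma aconvA_aux f g h N n : (0 < n < N)%N -> aconv f (aconv g h) n =
  \sum_(i < N) \sum_(k < N) \sum_(l < N)
    (f i * (g k * h l)) *+ (i * (k * l) == n)%N.
Proof.
move=> nN; have /andP[n0 nN'] := nN.
rewrite (@aconvE N)//; apply: eq_bigr => i _.
transitivity (\sum_(j < N) \sum_(k < N) \sum_(l < N)
   (f i * (g k * h l)) *+ ((k * l == j) && (i * j == n))%N).
  apply: eq_bigr => j _; case: (boolP (i * j == n)%N) => [/eqP ijn|_]; last first.
    by rewrite mulr0n big1// => k _; rewrite big1// => l _; rewrite andbF.
  rewrite mulr1n (@aconvE N) ?ltn_ord ?andbT; last first.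
    by move: n0; rewrite -ijn muln_gt0 => /andP[].
  rewrite mulr_sumr; apply: eq_bigr => k _.
  by rewrite mulr_sumr; apply: eq_bigr => l _; rewrite andbT mulrnAr.
rewrite exchange_big; apply: eq_bigr => k _.
rewrite exchange_big; apply: eq_bigr => l _.
case: (boolP (i * (k * l) == n)%N) => [/eqP e|ne].
  have klN : (k * l < N)%N.
    apply: leq_ltn_trans nN'; rewrite -e leq_pmull//.
    by move: n0; rewrite -e muln_gt0 => /andP[].
  rewrite (bigD1 (Ordinal klN))//= e !eqxx big1 ?addr0// => j /eqP jkl.
  by case: eqP => // klj; case: jkl; exact: val_inj.
rewrite big1// => j _; case: eqP => // <-.
by rewrite (negbTE ne).
Qed.

Lemma aconvA : associative aconv.
Proof.
move=> f g h; apply: arithP => n n0.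
have nn : (0 < n < n.+1)%N by rewrite n0 ltnS leqnn.
rewrite [aconv (aconv f g) h]aconvC !(aconvA_aux _ _ _ nn).
rewrite [RHS]exchange_big; apply: eq_bigr => i _.
rewrite [RHS]exchange_big; apply: eq_bigr => k _; apply: eq_bigr => l _.
by rewrite [h l * _]mulrC mulrA [(l * _)%N]mulnC mulnA.
Qed.

Lemma aconv1 : left_id aone aconv.
Proof.
move=> f; apply: arithP => n n0.
have nn : (0 < n < n.+1)%N by rewrite n0 ltnS leqnn.
rewrite (aconvE _ _ nn).
have n1 : (1 < n.+1)%N by rewrite ltnS.
rewrite (bigD1 (Ordinal n1))//= [X in _ + X]big1 ?addr0; last first.
  move=> i /eqP i1; rewrite big1// => j _.
  have /negbTE -> : i != 1%N :> nat.
    by apply/eqP => i1'; apply: i1; exact: val_inj.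
  by rewrite mul0r mul0rn.
rewrite (bigD1 (Ordinal (ltnSn n)))//= mul1n eqxx mul1r mulr1n.
rewrite big1 ?addr0// => j /eqP jn; rewrite mul1n.
case: eqP => // jn'; case: jn; exact: val_inj.
Qed.

Lemma aconvDl : left_distributive aconv +%R.
Proof.
move=> f g h; apply: arithP => n _ /=.
by rewrite -big_split; apply: eq_bigr => d _; rewrite mulrDl.
Qed.

Lemma aone_neq0 : aone != 0.
Proof.
apply/eqP => /(congr1 (fun f : arith => f 1%N)) /= /eqP.
by rewrite oner_eq0.
Qed.

HB.instance Definition _ := GRing.Zmodule_isComNzRing.Build arith
  aconvA aconvC aconv1 aconvDl aone_neq0.

Lemma aaddE f g n : (f + g) n = f n + g n. Proof. by []. Qed.
Lemma aoppE f n : (- f) n = - f n. Proof. by []. Qed.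
Lemma amulE f g n : (f * g) n = \sum_(d <- divisors n) f d * g (n %/ d)%N.
Proof. by []. Qed.

Lemma ascaleA a b f : ascale a (ascale b f) = ascale (a * b) f.
Proof. by apply: arithP => n _ /=; rewrite mulrA. Qed.
Lemma ascale1 : left_id 1 ascale.
Proof. by move=> f; apply: arithP => n _ /=; rewrite mul1r. Qed.
Lemma ascaleDr : right_distributive ascale +%R.
Proof. by move=> a f g; apply: arithP => n _ /=; rewrite mulrDr. Qed.
Lemma ascaleDl f : {morph ascale^~ f : a b / a + b}.
Proof. by move=> a b; apply: arithP => n _ /=; rewrite mulrDl. Qed.

HB.instance Definition _ := GRing.Zmodule_isLmodule.Build R[i] arith
  ascaleA ascale1 ascaleDr ascaleDl.

Lemma ascaleE a f n : (a *: f) n = a * f n. Proof. by []. Qed.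

Lemma ascaleAl (a : R[i]) f g : a *: (f * g) = a *: f * g.
Proof.
apply: arithP => n _; rewrite ascaleE !amulE mulr_sumr.
by apply: eq_bigr => d _; rewrite ascaleE mulrA.
Qed.

HB.instance Definition _ := GRing.Lmodule_isLalgebra.Build R[i] arith ascaleAl.

Lemma ascaleAr (a : R[i]) f g : a *: (f * g) = f * (a *: g).
Proof. by rewrite mulrC ascaleAl mulrC. Qed.

HB.instance Definition _ := GRing.Lalgebra_isAlgebra.Build R[i] arith ascaleAr.

(* The constant [a] is the arithmetic function [a%:A]. *)
Lemma aconstE (a : R[i]) n : (a%:A : arith) n = if n == 1%N then a else 0.
Proof. by rewrite ascaleE /=; case: eqP; rewrite ?mulr1 ?mulr0. Qed.

(* The order of [f]; the order of 0 is set to 0 instead of infinity, so that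
   its inverse is 0 in both cases. *)
Definition aorder f : nat :=
  if pselect (exists n, f n != 0) is left nz then ex_minn nz else 0%N.

Lemma aorder_min f n : f n != 0 -> (aorder f <= n)%N.
Proof.
rewrite /aorder; case: pselect => // nz fn.
by case: ex_minnP => m _; apply.
Qed.

Lemma aorder_neq0 f : f != 0 -> f (aorder f) != 0.
Proof.
move=> f0; rewrite /aorder; case: pselect => [nz|z]; first by case: ex_minnP.
exfalso; case/eqP: f0; apply: arithP => n _; apply/eqP/negPn/negP => fn.
by apply: z; exists n.
Qed.

Lemma aorder_gt0 f : f != 0 -> (0 < aorder f)%N.
Proof.
by move/aorder_neq0; rewrite lt0n; apply: contra => /eqP ->; rewrite arith0.
Qed.

Lemma aorder0 : aorder 0 = 0%N.
Proof.
by rewrite /aorder; case: pselect => // nz; exfalso; case: nz => n; rewrite eqxx.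
Qed.

Lemma amul_aorder f g : f != 0 -> g != 0 ->
  (f * g) (aorder f * aorder g)%N = f (aorder f) * g (aorder g).
Proof.
move=> f0 g0; set a := aorder f; set b := aorder g.
have a0 : (0 < a)%N := aorder_gt0 f0; have b0 : (0 < b)%N := aorder_gt0 g0.
have ab0 : (0 < a * b)%N by rewrite muln_gt0 a0.
rewrite amulE (bigD1_seq a) ?divisors_uniq//=; last first.
  by rewrite -dvdn_divisors// dvdn_mulr.
rewrite mulKn// big_seq_cond big1 ?addr0// => d.
rewrite -dvdn_divisors// => /andP[/dvdnP[q abE] da].
have [fd|] := eqVneq (f d) 0; first by rewrite fd mul0r.
move=> /aorder_min; rewrite -/a leq_eqVlt eq_sym (negbTE da)/= => ltad.
have d0 : (0 < d)%N by apply: leq_trans ltad.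
have [gq|] := eqVneq (g q) 0; first by rewrite abE mulnK// gq mulr0.
move=> /aorder_min; rewrite -/b => bq; exfalso.
have : (a * b < q * d)%N.
  apply: (@leq_ltn_trans (q * a)); first by rewrite mulnC leq_mul2r bq orbT.
  by rewrite ltn_pmul2l// (leq_trans b0).
by rewrite abE ltnn.
Qed.

Definition aunit : pred arith := fun f => `[< exists g, g * f = 1 >].
Definition ainv f : arith :=
  if pselect (exists g, g * f = 1) is left u then projT1 (cid u) else f.

Lemma amulVx : {in aunit, left_inverse 1 ainv *%R}.
Proof.
by move=> f /asboolP u; rewrite /ainv; case: pselect => // u'; case: cid.
Qed.
Lemma aunitP f g : g * f = 1 -> aunit f.
Proof. by move=> gf; apply/asboolP; exists g. Qed.
Lemma ainv_out : {in [predC aunit], ainv =1 id}.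
Proof.
by move=> f /asboolPn u; rewrite /ainv; case: pselect.
Qed.

HB.instance Definition _ :=
  GRing.ComNzRing_hasMulInverse.Build arith amulVx aunitP ainv_out.

Lemma aintegral f g : f * g = 0 -> (f == 0) || (g == 0).
Proof.
move=> fg; apply/norP => -[f0 g0]; have := amul_aorder f0 g0.
rewrite fg => /esym/eqP; rewrite mulf_eq0.
by rewrite !(negbTE (aorder_neq0 _)).
Qed.

HB.instance Definition _ :=
  GRing.ComUnitRing_isIntegral.Build arith aintegral.

Definition anorm f : R := (aorder f)%:R^-1.

Lemma anorm_eq0 f : anorm f = 0 -> f = 0.
Proof.
move/eqP; rewrite invr_eq0 pnatr_eq0; apply: contraTeq => /aorder_gt0.
by rewrite lt0n.
Qed.

Lemma anorm0 : anorm 0 = 0. Proof. by rewrite /anorm aorder0 invr0. Qed.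

Lemma anormN f : anorm (- f) = anorm f.
Proof.
have nN h : (aorder h <= aorder (- h))%N.
  have [->|h0] := eqVneq h 0; first by rewrite oppr0.
  apply: aorder_min; rewrite -oppr_eq0 -aoppE.
  by apply: aorder_neq0; rewrite oppr_eq0.
by congr (_%:R^-1); apply/eqP; rewrite eqn_leq nN -{2}(opprK f) nN.
Qed.

Lemma anormD f g : anorm (f + g) <= Num.max (anorm f) (anorm g).
Proof.
have [->|fg0] := eqVneq (f + g) 0.
  by rewrite anorm0 le_max invr_ge0 ler0n.
have le_anorm h : h (aorder (f + g)) != 0 -> anorm (f + g) <= anorm h.
  move=> hn; have h0 : h != 0 by apply: contraNneq hn => ->.
  by rewrite lef_pV2 ?posrE ?ltr0n ?aorder_gt0// ler_nat aorder_min.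
have := aorder_neq0 fg0; rewrite aaddE.
have [->|/le_anorm fn _] := eqVneq (f (aorder (f + g))) 0; last first.
  by rewrite le_max fn.
by rewrite add0r => /le_anorm gn; rewrite le_max gn orbT.
Qed.

Definition adist f g := anorm (f - g).

Lemma adistxx f : adist f f = 0. Proof. by rewrite /adist subrr anorm0. Qed.
Lemma adist_positivity f g : adist f g = 0 -> f = g.
Proof. by move/anorm_eq0/eqP; rewrite subr_eq0 => /eqP. Qed.
Lemma adist_sym f g : adist f g = adist g f.
Proof. by rewrite /adist -anormN opprB. Qed.
Lemma adist_triangle g f h : adist f h <= adist f g + adist g h.
Proof.
rewrite /adist -(subrKA g); apply: le_trans (anormD _ _) _.
by rewrite ge_max lerDl lerDr !invr_ge0 !ler0n.
Qed.

HB.instance Definition _ := isMetric.Build R arith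
  adistxx adist_positivity adist_sym adist_triangle.
HB.instance Definition _ := isPointed.Build arith 0.

Definition cexp (z : R[i]) : R[i] :=
  ((expR (complex.Re z))%:C * (cos (complex.Im z) +i* sin (complex.Im z)))%C.

(* For [f] vanishing at 1. *)
Definition Exp0 f : arith :=
  limn (series (fun k => (k`!%:R^-1 : R[i]) *: f ^+ k)).

Definition Exp f : arith :=
  (cexp (f 1%N))%:A * Exp0 (f - (f 1%N)%:A).

Definition derivation (D : arith -> arith) : Prop :=
  linear D /\ forall f g, D (f * g) = D f * g + f * D g.

End Arith.
Arguments arith R : clear implicits.

Notation "x %:F" := (@tofrac _ x) : ring_scope.

Section FractionDerivation.
Variable A : idomainType.
Implicit Types (D : A -> A) (a b : A) (x y : {fraction A}).

(* The extension of [D] to the field of fractions, by the quotient rule; see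
   [fder_uniq]. *)
Definition fder D x : {fraction A} :=
  let a := \n_(repr x) in let b := \d_(repr x) in
  ((D a)%:F * b%:F - a%:F * (D b)%:F) / b%:F ^+ 2.

Lemma denom_neq0 x : \d_(repr x) != 0. Proof. exact: denom_ratioP. Qed.

Lemma frac_split x : x = (\n_(repr x))%:F / (\d_(repr x))%:F.
Proof.
apply: (@mulIf _ (\d_(repr x))%:F); rewrite ?tofrac_eq0 ?denom_neq0//.
rewrite divfK ?tofrac_eq0 ?denom_neq0//.
rewrite -{1}(reprK x); set r := repr x.
rewrite !piE; apply/eqmodP; rewrite /= FracField.equivfE /FracField.mulf.
by rewrite !numden_Ratio ?mulf_neq0 ?oner_neq0 ?denom_ratioP// !mulr1 mulrC.
Qed.

Lemma quotient_rule_aux (F : fieldType) (a b n d Da Db Dn Dd : F) :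
    b != 0 -> d != 0 -> a * d = n * b -> Da * d + a * Dd = Dn * b + n * Db ->
  (Dn * d - n * Dd) / d ^+ 2 = (Da * b - a * Db) / b ^+ 2.
Proof.
move=> b0 d0 nd Dnd; apply/eqP; rewrite eqr_div ?expf_neq0//; apply/eqP.
have -> : (Dn * d - n * Dd) * b ^+ 2 = d * b * (Dn * b) - n * b * b * Dd.
  by ring.
have -> : Dn * b = Da * d + a * Dd - n * Db by rewrite Dnd; ring.
have -> : d * b * (Da * d + a * Dd - n * Db) - n * b * b * Dd =
  d * b * (Da * d + a * Dd) - d * (n * b) * Db - n * b * b * Dd by ring.
by rewrite -nd; ring.
Qed.

Lemma fderM_aux (F : fieldType) (a b c d Da Db Dc Dd : F) :
    b != 0 -> d != 0 ->
  ((Da * c + a * Dc) * (b * d) - a * c * (Db * d + b * Dd)) / (b * d) ^+ 2 =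
  (Da * b - a * Db) / b ^+ 2 * (c / d) + a / b * ((Dc * d - c * Dd) / d ^+ 2).
Proof. by move=> b0 d0; field; rewrite b0 d0. Qed.

Lemma fderD_aux (F : fieldType) (a b c d Da Db Dc Dd : F) :
    b != 0 -> d != 0 ->
  ((Da * d + a * Dd + (Dc * b + c * Db)) * (b * d) -
    (a * d + c * b) * (Db * d + b * Dd)) / (b * d) ^+ 2 =
  (Da * b - a * Db) / b ^+ 2 + (Dc * d - c * Dd) / d ^+ 2.
Proof. by move=> b0 d0; field; rewrite b0 d0. Qed.

Lemma fder_uniq_aux (F : fieldType) (a b Da Db : F) : b != 0 ->
  Da - a / b * Db = (Da * b - a * Db) / b ^+ 2 * b.
Proof. by move=> b0; field. Qed.

Lemma fder_div D a b : {morph D : a b / a + b} ->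
    (forall a b, D (a * b) = D a * b + a * D b) -> b != 0 ->
  fder D (a%:F / b%:F) = ((D a)%:F * b%:F - a%:F * (D b)%:F) / b%:F ^+ 2.
Proof.
move=> DD DM b0; rewrite /fder; set x := a%:F / b%:F.
have d0 := denom_neq0 x; have := frac_split x; rewrite {1}/x.
move: (\n_(repr x)) (\d_(repr x)) d0 => n d d0 /eqP.
rewrite eqr_div ?tofrac_eq0// -!tofracM tofrac_eq => /eqP nd.
have /(congr1 (@tofrac A)) : D a * d + a * D d = D n * b + n * D b.
  by rewrite -!DM nd.
have /(congr1 (@tofrac A)) := nd; rewrite !tofracD !tofracM.
by apply: quotient_rule_aux; rewrite tofrac_eq0.
Qed.

Section FractionDerivationTheory.
Variable D : A -> A.
Hypothesis DD : {morph D : a b / a + b}.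
Hypothesis DM : forall a b, D (a * b) = D a * b + a * D b.

Lemma fder_tofrac a : fder D a%:F = (D a)%:F.
Proof.
have D1 : D 1 = 0.
  by have /esym/eqP := DM 1 1; rewrite !mulr1 mul1r -subr_eq0 addrK => /eqP.
rewrite -[X in fder D X]divr1 -tofrac1 fder_div ?oner_neq0//.
by rewrite D1 tofrac0 tofrac1 mulr0 subr0 mulr1 expr1n divr1.
Qed.

Lemma fderM x y : fder D (x * y) = fder D x * y + x * fder D y.
Proof.
have b0 := denom_neq0 x; have d0 := denom_neq0 y.
rewrite (frac_split x) (frac_split y).
move: (\n_(repr x)) (\d_(repr x)) (\n_(repr y)) (\d_(repr y)) b0 d0.
move=> a b c d b0 d0; rewrite mulf_div -!tofracM !fder_div ?mulf_neq0//.
rewrite !DM !tofracD !tofracM.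
by apply: fderM_aux; rewrite tofrac_eq0.
Qed.

Lemma fderD : {morph fder D : x y / x + y}.
Proof.
move=> x y; have b0 := denom_neq0 x; have d0 := denom_neq0 y.
rewrite (frac_split x) (frac_split y).
move: (\n_(repr x)) (\d_(repr x)) (\n_(repr y)) (\d_(repr y)) b0 d0.
move=> a b c d b0 d0; rewrite addf_div ?tofrac_eq0// -!tofracM -tofracD.
rewrite !fder_div ?mulf_neq0// !DD !DM !tofracD !tofracM.
by apply: fderD_aux; rewrite tofrac_eq0.
Qed.

Lemma fder_uniq (E : {fraction A} -> {fraction A}) :
    (forall x y, E (x * y) = E x * y + x * E y) ->
    (forall a, E a%:F = (D a)%:F) ->
  E =1 fder D.
Proof.
move=> EM ED x; have b0 := denom_neq0 x; rewrite (frac_split x).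
move: (\n_(repr x)) (\d_(repr x)) b0 => a b b0; rewrite fder_div//.
have bF0 : b%:F != 0 :> {fraction A} by rewrite tofrac_eq0.
have := EM (a%:F / b%:F) b%:F; rewrite divfK// !ED => /eqP.
rewrite -subr_eq => /eqP Eab; apply: (mulIf bF0).
by rewrite -Eab; apply: fder_uniq_aux.
Qed.

End FractionDerivationTheory.

(* The subfield $\ker_F \Delta$. *)
Definition kerF (Delta : set (A -> A)) : {pred {fraction A}} :=
  fun x => `[< forall D, Delta D -> fder D x = 0 >].

End FractionDerivation.

Section Fields.
Context {F : fieldType}.
Implicit Types K L S : {pred F}.

Definition adjoin K S : {pred F} := fun x =>
  `[< forall L, GRing.divring_closed L -> {subset K <= L} -> {subset S <= L} ->
      x \in L >].

Definition alg_indep K m (x : 'I_m -> F) : Prop :=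
  forall p : mpoly m F, p \is a mpolyOver m K -> meval x p = 0 -> p = 0.

(* The largest size of a family of elements of [L] that is algebraically
   independent over [K], or [+oo] if there is no largest one. *)
Definition trdeg (R : realType) K L : \bar R :=
  ereal_sup [set m%:R%:E | m in [set m | exists x : 'I_m -> F,
    (forall i, x i \in L) /\ alg_indep K x]].

(* The rank of the matrix with rows [a t], [t] ranging over the possibly
   infinite set [T]: the largest number of linearly independent rows, which is
   at most the number [n] of columns. *)
Definition rank_rows {I : Type} (T : set I) n (a : I -> 'I_n -> F) : nat :=
  (\max_(r < n.+1 | `[< exists t : 'I_r -> I, (forall j, T (t j)) /\
    row_free (\matrix_(j < r, i < n) a (t j) i) >]) r)%N.

Definition mult_indep_mod K n (z : 'I_n -> F) : Prop :=
  forall k : 'I_n -> int,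
    let y := \prod_i z i ^ k i in
    y \in K -> y != 0 -> forall i, k i = 0.

Definition rat_indep_mod K n (x : 'I_n -> F) : Prop :=
  forall q : 'I_n -> rat, \sum_i ratr (q i) * x i \in K -> forall i, q i = 0.

End Fields.

(* Main.v *)
From HB Require Import structures.
Require Import Defs.
From mathcomp Require Import all_boot all_order all_algebra.
From mathcomp Require Import complex ring separable.
From mathcomp Require Import -(notations) mpoly.
From mathcomp Require Import all_classical all_reals.
From mathcomp Require Import ereal topology sequences exp trigo.

Set Implicit Arguments.
Unset Strict Implicit.
Unset Printing Implicit Defensive.

Import Order.TTheory GRing.Theory Num.Theory.
Local Open Scope classical_set_scope.
Local Open Scope ring_scope.

(** Write [F] for the field of fractions, [C] for the constants of [Delta],
    [x i] for [f i] and [y i] for [Exp (f i)].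

    Only a few features of arithmetic functions matter.  A derivation [D] that
    is continuous can be applied termwise to the exponential series, so
    [D (y i) = y i * D (x i)] ([derivation_Exp]); by this differential equation
    the [y i] are multiplicatively independent modulo [C] as soon as the [x i]
    are linearly independent over the rationals modulo [C]
    ([rat_indep_mult_indep]).  The rest is Ax's theorem on fields of
    characteristic zero with derivations ([ax_schanuel]).

    Consider all derivations [E] of [F] that vanish on [C], and the forms
    [w i : E |-> E (x i) - E (y i) / y i], that is [dx_i - dy_i / y_i].  They
    vanish on [Delta].  If they are linearly independent over [F], then
    derivations dual to them, together with derivations of [Delta], give
    [n + rank] derivations with independent values on the [x i] and [y i], and
    the Jacobian criterion ([alg_indep_jacobian]) yields as many algebraically
    independent elements.

    The independence of the forms ([exp_form_independence]) is the core.  A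
    shortest relation, normalized to have a coefficient 1, is shortened by every
    [D] in [Delta] because [D (w i E) = w i [D, E]]; hence its coefficients
    [c i] are constants, and it reads [\sum_i c i * (E (y i) / y i) = E v] with
    [v = \sum_i c i * x i].  To exclude this ([log_independence]), let
    [t = y 0]; it is transcendental over [C], as [C] is algebraically closed in
    [F].  Choose a maximal subring [k] of [F] that contains [C] and over which
    [t] is transcendental; then [k] is a field and [F] is algebraic over [k(t)]
    ([algebraic_over_rational]), so that [d/dt] extends to a derivation [E] of
    [F] ([leibniz_extension]).  Norms and traces bring the relation down to
    [k(t)] ([norm_relation]), where the residue at [t = 0] of [dN / N] is the
    order of [N] and that of an exact differential is zero ([order0],
    [value0_exact]).  This is a relation with integer coefficients between the
    [c i], in which the coefficient of [c 0] is the degree of a field extension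
    ([integer_relation]).  It eliminates one logarithm, and induction on [n]
    shows that all [c i] vanish. *)

(** * Derivations and logarithmic derivatives *)

Definition leibniz (A : nzRingType) (E : A -> A) : Prop :=
  {morph E : x y / x + y} /\ forall x y, E (x * y) = E x * y + x * E y.

Section RingDerivation.
Variables (A : comNzRingType) (E : A -> A).
Hypothesis hE : leibniz E.

Lemma derD x y : E (x + y) = E x + E y. Proof. by case: hE. Qed.
Lemma derM x y : E (x * y) = E x * y + x * E y. Proof. by case: hE. Qed.

Lemma der0 : E 0 = 0.
Proof. by apply: (addrI (E 0)); rewrite -derD !addr0. Qed.

Lemma derN x : E (- x) = - E x.
Proof. by apply: (addrI (E x)); rewrite -derD !subrr der0. Qed.

Lemma derB x y : E (x - y) = E x - E y. Proof. by rewrite derD derN. Qed.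

Lemma der1 : E 1 = 0.
Proof. by apply: (addrI (E 1)); rewrite addr0 -{3}[1]mulr1 derM mulr1 mul1r. Qed.

Lemma der_sum I (r : seq I) (P : pred I) (G : I -> A) :
  E (\sum_(i <- r | P i) G i) = \sum_(i <- r | P i) E (G i).
Proof. exact: (big_morph E derD der0). Qed.

Lemma der_int (m : int) : E m%:~R = 0.
Proof.
have Enat n : E n%:R = 0.
  by elim: n => [|n IHn]; rewrite ?der0// -natr1 derD IHn der1 addr0.
by case: m => n; rewrite ?NegzE ?mulrNz ?derN -pmulrn Enat ?oppr0.
Qed.

Lemma der_exp x n : E (x ^+ n.+1) = n.+1%:R * x ^+ n * E x.
Proof.
elim: n => [|n IHn]; first by rewrite !expr1 expr0 !mul1r.
by rewrite exprS derM IHn -[in RHS]natr1 !exprS; ring.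
Qed.

End RingDerivation.

Definition dlog (F : fieldType) (E : F -> F) (x : F) : F := E x / x.

Section FieldDerivation.
Variables (F : fieldType) (E : F -> F).
Hypothesis hE : leibniz E.

Lemma dlog1 : dlog E 1 = 0. Proof. by rewrite /dlog der1// mul0r. Qed.

Lemma dlogM x y : x != 0 -> y != 0 -> dlog E (x * y) = dlog E x + dlog E y.
Proof.
by move=> x0 y0; rewrite /dlog derM//; field; rewrite x0 y0.
Qed.

Lemma dlogV x : x != 0 -> dlog E x^-1 = - dlog E x.
Proof.
move=> x0; apply/eqP; rewrite -addr_eq0 -dlogM ?invr_eq0//.
by rewrite mulVf// dlog1.
Qed.

Lemma derV x : x != 0 -> E x^-1 = - E x / x ^+ 2.
Proof.
move=> x0; have := dlogV x0; rewrite /dlog invrK => /(canRL (mulfK x0)) ->.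
by field.
Qed.

Lemma dlogX x n : x != 0 -> dlog E (x ^+ n) = n%:R * dlog E x.
Proof.
move=> x0; elim: n => [|n IHn]; first by rewrite expr0 dlog1 mul0r.
by rewrite exprS dlogM ?expf_neq0// IHn -natr1; ring.
Qed.

Lemma dlogXz x (k : int) : x != 0 -> dlog E (x ^ k) = k%:~R * dlog E x.
Proof.
move=> x0; case: k => n; first by rewrite -exprnP dlogX// -pmulrn.
by rewrite NegzE -exprnN dlogV ?expf_neq0// dlogX// rmorphN mulNr /= -pmulrn.
Qed.

Lemma dlog_div x y : x != 0 -> y != 0 -> dlog E (x / y) = dlog E x - dlog E y.
Proof. by move=> x0 y0; rewrite dlogM ?invr_eq0// dlogV. Qed.

Lemma dlog_laurent u v x a b : u != 0 -> v != 0 -> x != 0 ->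
  x * dlog E (u / v * (x ^+ a / x ^+ b)) =
  x * dlog E u - x * dlog E v + (a%:R - b%:R) * E x.
Proof.
move=> u0 v0 x0; rewrite dlogM ?mulf_neq0 ?invr_eq0 ?expf_neq0//.
rewrite !dlog_div ?expf_neq0// !dlogX// /dlog.
by field; rewrite x0 v0 u0.
Qed.

Lemma dlog_prod I (r : seq I) (G : I -> F) : (forall i, G i != 0) ->
  dlog E (\prod_(i <- r) G i) = \sum_(i <- r) dlog E (G i).
Proof.
move=> G0; elim: r => [|i r IHr]; first by rewrite !big_nil dlog1.
rewrite !big_cons dlogM// ?IHr//; elim/big_rec: _ => [|j x _ x0].
  exact: oner_neq0.
by rewrite mulf_neq0.
Qed.

End FieldDerivation.

Lemma leibniz_fder (A : idomainType) (D : A -> A) :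
  leibniz D -> leibniz (fder D).
Proof. by case=> DD DM; split; [exact: fderD|exact: fderM]. Qed.

Lemma leibniz_deriv (k : comNzRingType) : leibniz (@deriv k).
Proof. by split=> p q; rewrite ?derivD ?derivM. Qed.

Lemma intr_eq0_pchar0 (F : fieldType) (m : int) : [pchar F] =i pred0 ->
  (m%:~R == 0 :> F) = (m == 0).
Proof.
by move=> /pcharf0P F0; case: m => n; rewrite ?NegzE ?mulrNz ?oppr_eq0 -pmulrn F0.
Qed.

(** * Residues at the origin of rational functions *)

Section Residue.
Variable k : fieldType.
Hypothesis k0 : [pchar k] =i pred0.
Local Notation K := {fraction {poly k}}.
Local Notation d := (fder (@deriv k)).
Local Notation X := ('X : {poly k})%:F.

Let hd : leibniz d := leibniz_fder (leibniz_deriv k).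

Let dF (p : {poly k}) : d p%:F = (p^`())%:F.
Proof. by case: (leibniz_deriv k) => ? ?; exact: fder_tofrac. Qed.

(** Having the value [e] at the origin: a relation, since [x] may have a pole
    there. *)
Definition value0 (x : K) (e : k) : Prop :=
  exists u v : {poly k}, [/\ v.[0] != 0, x = u%:F / v%:F & e = u.[0] / v.[0]].

Let F0 (v : {poly k}) : v.[0] != 0 -> v%:F != 0 :> K.
Proof. by rewrite tofrac_eq0; apply: contraNneq => ->; rewrite horner0. Qed.

Lemma value0_uniq x e e' : value0 x e -> value0 x e' -> e = e'.
Proof.
move=> [u [v [v0 -> ->]]] [u' [v' [v'0 + ->]]] => /eqP.
rewrite eqr_div ?F0// -!tofracM tofrac_eq => /eqP/(congr1 (horner^~ 0)).
by rewrite !hornerM => e1; apply/eqP; rewrite eqr_div// e1.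
Qed.

Lemma value0_poly p : value0 p%:F p.[0].
Proof. by exists p, 1; rewrite hornerC oner_neq0 tofrac1 !divr1. Qed.

Lemma value0X : value0 X 0.
Proof. by have := value0_poly 'X; rewrite hornerX. Qed.

Lemma value0C c : value0 (c%:P)%:F c.
Proof. by have := value0_poly c%:P; rewrite hornerC. Qed.

Lemma value0D x y e f : value0 x e -> value0 y f -> value0 (x + y) (e + f).
Proof.
move=> [u [v [v0 -> ->]]] [u' [v' [v'0 -> ->]]].
exists (u * v' + u' * v), (v * v'); rewrite hornerM mulf_neq0//.
by rewrite !addf_div ?F0// !(tofracD, tofracM) hornerD !hornerM.
Qed.

Lemma value0M x y e f : value0 x e -> value0 y f -> value0 (x * y) (e * f).
Proof.
move=> [u [v [v0 -> ->]]] [u' [v' [v'0 -> ->]]].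
exists (u * u'), (v * v'); rewrite hornerM mulf_neq0//.
by rewrite !mulf_div !tofracM !hornerM.
Qed.

Lemma value0V x e : e != 0 -> value0 x e -> value0 x^-1 e^-1.
Proof.
move=> e0 [u [v [v0 xE eE]]]; exists v, u; rewrite xE eE !invf_div; split=> //.
by move: e0; rewrite eE mulf_eq0 => /norP[].
Qed.

Lemma value0_sum n (x : 'I_n -> K) (e : 'I_n -> k) :
  (forall i, value0 (x i) (e i)) -> value0 (\sum_i x i) (\sum_i e i).
Proof.
move=> xe; elim/big_rec2: _ => [|i f y _ yf]; last exact: value0D.
by rewrite -tofrac0; exact: value0C.
Qed.

Lemma value0_der x e : value0 x e -> exists f, value0 (d x) f.
Proof.
move=> [u [v [v0 -> _]]].
have [DD DM] := leibniz_deriv k.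
have v0' : v != 0 by rewrite -tofrac_eq0 F0.
rewrite (fder_div _ DD DM v0'); eexists; exists (u^`() * v - u * v^`()), (v ^+ 2).
rewrite horner_exp expf_neq0//; split=> //.
by rewrite !(tofracB, tofracM, tofracXn).
Qed.

(** The residue of [dx / x] at the origin is the order [m] of [x]: a factor ['X]
    contributes 1, and a polynomial that does not vanish at the origin
    contributes 0. *)
Lemma order0 x : x != 0 -> exists m : int,
  [/\ value0 (X * dlog d x) m%:~R, 0 <= m -> exists e, value0 x e
    & m < 0 -> value0 x^-1 0].
Proof.
move=> x0; have X0 : X != 0 by rewrite tofrac_eq0 polyX_eq0.
have factor (p : {poly k}) : p != 0 -> exists a q, q.[0] != 0 /\ p = q * 'X^a.
  move=> p0; have [a [q]] := multiplicity_XsubC p 0.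
  by rewrite p0 /root subr0 => ? ->; exists a, q.
have dlog_poly (q : {poly k}) : q.[0] != 0 -> value0 (X * dlog d q%:F) 0.
  move=> q0; rewrite -(mul0r (q^`().[0] / q.[0])) /dlog dF.
  apply: value0M value0X _; apply: value0M; first exact: value0_poly.
  by apply: value0V => //; exact: value0_poly.
have dX : d X = 1 by rewrite dF derivX tofrac1.
have n0 : \n_(repr x) != 0.
  by apply: contraNneq x0 => n0; rewrite (frac_split x) n0 tofrac0 mul0r.
have [a [p [p0 pE]]] := factor _ n0.
have [b [q [q0 qE]]] := factor _ (denom_neq0 x).
have {n0 pE qE} xE : x = p%:F / q%:F * (X ^+ a / X ^+ b).
  by rewrite (frac_split x) pE qE !tofracM !tofracXn -mulf_div.
have pq : value0 (p%:F / q%:F) (p.[0] / q.[0]) by exists p, q.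
have pq0 : p.[0] / q.[0] != 0 by rewrite mulf_neq0// invr_eq0.
exists (a%:Z - b%:Z); split.
- have p0' := F0 p0; have q0' := F0 q0.
  have -> : X * dlog d x =
      X * dlog d p%:F + (-1%:P)%:F * (X * dlog d q%:F) + (a%:R - b%:R).
    rewrite xE (dlog_laurent hd _ _ p0' q0' X0) dX mulr1.
    by rewrite tofracN tofrac1 mulN1r.
  have -> : (a%:Z - b%:Z)%:~R = 0 + (-1) * 0 + (a%:R - b%:R) :> k.
    by rewrite mulr0 !add0r rmorphB.
  apply: value0D.
    apply: value0D; first exact: dlog_poly.
    apply: value0M; last exact: dlog_poly.
    by rewrite -polyCN; exact: value0C.
  have -> : a%:R - b%:R = ((a%:R - b%:R)%:P)%:F :> K.
    by rewrite rmorphB tofracB /= !rmorph_nat.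
  exact: value0C.
- rewrite subr_ge0 lez_nat => ba; exists (p.[0] / q.[0] * (('X^(a - b)).[0])).
  rewrite xE; have <- : ('X^(a - b))%:F = X ^+ a / X ^+ b :> K.
    by rewrite tofracXn; apply: expfB_cond; rewrite (negbTE X0).
  by apply: value0M pq _; exact: value0_poly.
- rewrite subr_lt0 ltz_nat => ab; rewrite xE invfM [X in _ * X]invf_div.
  have <- : ('X^(b - a))%:F = X ^+ b / X ^+ a :> K.
    by rewrite tofracXn; apply: expfB_cond; rewrite (negbTE X0) ltnW.
  have -> : 0 = (p.[0] / q.[0])^-1 * ('X^(b - a) : {poly k}).[0].
    by rewrite hornerXn expr0n subn_eq0 leqNgt ab mulr0.
  by apply: value0M; [exact: value0V|exact: value0_poly].
Qed.

(** Differentiating a pole makes it of order at least two, so an exact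
    differential has no residue. *)
Lemma value0_exact w e : value0 (X * d w) e -> e = 0.
Proof.
have [->|w0] := eqVneq w 0.
  rewrite der0// mulr0 => /value0_uniq; apply.
  by rewrite -tofrac0; exact: value0C.
move=> we; have [m [ordm reg pole]] := order0 w0.
case: (leP 0 m) => [/reg[f /value0_der[g wg]]|m0].
  by apply: value0_uniq we _; rewrite -(mul0r g); apply: value0M value0X _.
have : value0 (X * dlog d w) (e * 0).
  by rewrite /dlog mulrA; apply: value0M we (pole m0).
move=> /(value0_uniq ordm); rewrite mulr0 => /eqP.
by rewrite intr_eq0_pchar0// => /eqP m00; move: m0; rewrite m00 ltxx.
Qed.

End Residue.

(** * Derivations of algebraic extensions *)

Section AlgebraicExtension.
Variables (K F : fieldType) (iota : {rmorphism K -> F}).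
Hypothesis K0 : [pchar K] =i pred0.
Hypothesis algF : forall z : F, algebraicOver iota z.
Local Notation ev q z := ((map_poly iota q).[z]).

(** An equation of least degree divides all others, and it is separable because
    in characteristic zero its derivative is nonzero and of smaller degree. *)
Lemma min_poly_exists z : exists P : {poly K},
  [/\ (1 < size P)%N, ev P z = 0, ev P^`() z != 0
    & forall q, ev q z = 0 -> P %| q].
Proof.
have exP : exists n, `[< exists P : {poly K}, [/\ P != 0, ev P z = 0 & size P = n] >].
  have [P P0 /rootP Pz] := algF z.
  by exists (size P); apply/asboolP; exists P.
case: (ex_minnP exP) => n /asboolP[P [P0 Pz Pn]] min.
have dvdP q : ev q z = 0 -> P %| q.
  move=> qz; apply/negPn/negP => Pq.
  have : (n <= size (q %% P)%R)%N.
    apply: min; apply/asboolP; exists (q %% P); split=> //.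
    by rewrite -[RHS]qz [in RHS](divp_eq q P) rmorphD rmorphM !hornerE Pz mulr0 add0r.
  by rewrite -Pn leqNgt ltn_modp P0.
have P1 : (1 < size P)%N.
  rewrite ltnNge; apply: contraTN isT => /size1_polyC PE.
  move: Pz; rewrite PE map_polyC hornerC => /eqP; rewrite fmorph_eq0 => /eqP c0.
  by move: P0; rewrite PE c0 eqxx.
exists P; split=> //; apply/negP => /eqP P'z.
have P'0 : P^`() != 0.
  apply/negP => /eqP P'0; have := coef_deriv P (size P).-2.
  rewrite P'0 coef0; have -> : (size P).-2.+1 = (size P).-1 by case: (size P) P1 => [|[]].
  move/esym/eqP; rewrite -mulr_natr mulf_eq0 -lead_coefE lead_coef_eq0 (negbTE P0).
  by have /pcharf0P -> := K0; case: (size P) P1 => [|[]].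
have : (n <= size P^`())%N by apply: min; apply/asboolP; exists P^`().
by rewrite -Pn leqNgt lt_size_deriv.
Qed.

Lemma primitive_pair x y : exists z, (exists p, x = ev p z) /\ exists q, y = ev q z.
Proof.
have [p p0 px] := algF x; have [q q0 qy] := algF y.
have [n [[r rx] [s sy]]] := pchar0_PET p0 px q0 qy K0.
by exists (y *+ n - x); split; [exists r|exists s].
Qed.

Lemma primitive_family n (x : 'I_n -> F) :
  exists z, forall i, exists p, x i = ev p z.
Proof.
elim: n x => [|n IHn] x; first by exists 0 => -[].
have [z xz] := IHn (x \o lift ord0).
have [w [[p zw] [q xw]]] := primitive_pair z (x ord0).
exists w => i; have [j ->|->] := unliftP ord0 i; last by exists q.
have [r /= ->] := xz j; exists (r \Po p).
by rewrite map_comp_poly horner_comp -zw.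
Qed.

Section Derivation.
Variable d : K -> K.
Hypothesis hd : leibniz d.
Local Notation dc := (map_poly d).

Let coef_d (p : {poly K}) i : (dc p)`_i = d p`_i.
Proof. by rewrite coef_map_id0 ?der0. Qed.

Let dD (p q : {poly K}) : dc (p + q) = dc p + dc q.
Proof. by apply/polyP => i; rewrite !(coef_d, coefD) derD. Qed.

Let dM (p q : {poly K}) : dc (p * q) = dc p * q + p * dc q.
Proof.
apply/polyP => i; rewrite !(coef_d, coefD, coefM) der_sum// -big_split.
by apply: eq_bigr => j _; rewrite derM// !coef_d.
Qed.

Let dC c : dc c%:P = (d c)%:P.
Proof. by apply/polyP => i; rewrite coef_d !coefC; case: eqP; rewrite ?der0. Qed.

Let dX : dc 'X = 0 :> {poly K}.
Proof.
by apply/polyP => i; rewrite coef_d coefX coef0; case: eqP; rewrite ?der1 ?der0.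
Qed.

(** The value at [q(z)] of a derivation that extends [d] and maps [z] to
    [w]. *)
Definition chain z w q : F := ev (dc q) z + ev q^`() z * w.

Lemma chainD z w p q : chain z w (p + q) = chain z w p + chain z w q.
Proof. by rewrite /chain dD derivD !rmorphD !hornerE /=; ring. Qed.

Lemma chainM z w p q :
  chain z w (p * q) = chain z w p * ev q z + ev p z * chain z w q.
Proof. by rewrite /chain dM derivM !(rmorphD, rmorphM) !hornerE /=; ring. Qed.

Lemma chainC z w c : chain z w c%:P = iota (d c).
Proof. by rewrite /chain dC derivC rmorph0 map_polyC !hornerE. Qed.

Lemma chainX z w : chain z w 'X = w.
Proof. by rewrite /chain dX derivX rmorph0 rmorph1 !hornerE. Qed.

Lemma chain_comp z w p q :
  chain z w (p \Po q) = chain (ev q z) (chain z w q) p.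
Proof.
elim/poly_ind: p => [|p c IHp].
  by rewrite comp_poly0 -[0]/(0%:P) !chainC.
rewrite comp_polyD comp_polyM comp_polyX comp_polyC !chainD !chainM !chainC.
by rewrite IHp !chainX map_comp_poly horner_comp map_polyX hornerX.
Qed.

Lemma der_chain (E : F -> F) z q : leibniz E -> (forall a, E (iota a) = iota (d a)) ->
  E (ev q z) = chain z (E z) q.
Proof.
move=> hE Ed; elim/poly_ind: q => [|q c IHq].
  by rewrite rmorph0 horner0 der0// -(polyC0 K) chainC der0// rmorph0.
rewrite chainD chainM chainC chainX -IHq !(rmorphD, rmorphM) /= map_polyX map_polyC.
by rewrite !hornerE derD// derM// Ed.
Qed.

(** The value [w] is a possible derivative of [z]: it is compatible with all
    algebraic equations of [z]. *)
Definition admissible z w := forall q, ev q z = 0 -> chain z w q = 0.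

Lemma admissible_exists z : exists w, admissible z w.
Proof.
have [P [_ Pz P'z dvdP]] := min_poly_exists z.
exists (- ev (dc P) z / ev P^`() z) => q /dvdP/dvdpP[s ->].
by rewrite chainM Pz mulr0 add0r /chain [ev P^`() z * _]mulrC divfK// addrN mulr0.
Qed.

Lemma admissible_uniq z w w' : admissible z w -> admissible z w' -> w = w'.
Proof.
have [P [_ Pz P'z _]] := min_poly_exists z.
move=> /(_ _ Pz) + /(_ _ Pz); rewrite /chain => <- /addrI /(mulfI P'z) /esym.
exact.
Qed.

Lemma admissible_chain z w q : admissible z w -> admissible (ev q z) (chain z w q).
Proof.
by move=> zw p pqz; rewrite -chain_comp zw// map_comp_poly horner_comp.
Qed.

(** The derivative of [z] is forced by any separable equation of [z], and a sum
    or product can be differentiated within one simple extension. *)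
Lemma leibniz_extension :
  exists E, leibniz E /\ forall a, E (iota a) = iota (d a).
Proof.
pose E z := projT1 (cid (admissible_exists z)).
have EP z : admissible z (E z) by rewrite /E; case: cid.
have Eq z q : E (ev q z) = chain z (E z) q.
  by apply: admissible_uniq (EP _) _; exact: admissible_chain.
exists E; split; [split|] => [x y|x y|a].
- have [z [[p ->] [q ->]]] := primitive_pair x y.
  by rewrite -hornerD -rmorphD !Eq chainD.
- have [z [[p ->] [q ->]]] := primitive_pair x y.
  by rewrite -hornerM -rmorphM !Eq chainM.
- by have := Eq 0 a%:P; rewrite map_polyC hornerC chainC.
Qed.

End Derivation.

End AlgebraicExtension.

(** * Traces and norms of logarithmic derivatives *)

Section MatrixDerivation.
Variables (K : fieldType) (d : K -> K).
Hypothesis hd : leibniz d.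

Lemma der_prod (I : eqType) (r : seq I) (G : I -> K) : uniq r ->
  d (\prod_(i <- r) G i) = \sum_(i <- r) d (G i) * \prod_(j <- r | j != i) G j.
Proof.
elim: r => [|x r IHr] /=; first by rewrite !big_nil der1.
move=> /andP[xr ur]; rewrite !big_cons derM// IHr// eqxx /=.
congr (_ + _).
  congr (_ * _); rewrite big_seq [RHS]big_seq_cond; apply: eq_bigl => j.
  by case: (boolP (j \in r)) => //= jr; rewrite (memPn xr).
rewrite mulr_sumr [LHS]big_seq [RHS]big_seq; apply: eq_bigr => i ir.
by rewrite big_cons (memPnC xr)// mulrCA.
Qed.

Lemma map_mx_derM m n p (A : 'M[K]_(m, n)) (B : 'M[K]_(n, p)) :
  map_mx d (A *m B) = map_mx d A *m B + A *m map_mx d B.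
Proof.
apply/matrixP => i j; rewrite !mxE der_sum// -big_split.
by apply: eq_bigr => l _; rewrite !mxE derM.
Qed.

Lemma der_tr n (A : 'M[K]_n) : d (\tr A) = \tr (map_mx d A).
Proof. by rewrite /mxtrace der_sum//; apply: eq_bigr => i _; rewrite mxE. Qed.

(** Jacobi's formula: by Leibniz, differentiate one row at a time, and expand
    each resulting determinant along that row. *)
Lemma der_det n (A : 'M[K]_n) : d (\det A) = \tr (\adj A *m map_mx d A).
Proof.
have signE (b : bool) : d ((-1) ^+ b) = 0.
  by case: b; rewrite ?expr0 ?expr1 ?derN// der1// oppr0.
pose N i := \matrix_(a, b) (if a == i then d (A a b) else A a b).
transitivity (\sum_i \det (N i)).
  rewrite /determinant der_sum// exchange_big; apply: eq_bigr => s _ /=.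
  rewrite derM// signE mul0r add0r der_prod ?index_enum_uniq// mulr_sumr.
  apply: eq_bigr => i _; congr (_ * _); rewrite [RHS](bigD1 i)//= mxE eqxx.
  by congr (_ * _); apply: eq_bigr => j /negbTE ji; rewrite mxE ji.
rewrite mxtrace_mulC /mxtrace; apply: eq_bigr => i _.
rewrite (expand_det_row _ i) mxE; apply: eq_bigr => j _.
rewrite !mxE eqxx; congr (_ * (_ * \det _)).
by apply/matrixP => a b; rewrite !mxE eq_sym (negbTE (neq_lift _ _)).
Qed.

Lemma dlog_det n (A : 'M[K]_n) : A \in unitmx ->
  dlog d (\det A) = \tr (map_mx d A *m invmx A).
Proof.
move=> uA; rewrite /dlog der_det mxtrace_mulC /invmx uA -scalemxAr linearZ /=.
by rewrite mulrC.
Qed.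

End MatrixDerivation.

Section Trace.
Variables (K F : fieldType) (iota : {rmorphism K -> F}).
Variables (d : K -> K) (E : F -> F).
Hypotheses (hd : leibniz d) (hE : leibniz E).
Hypothesis Ed : forall a, E (iota a) = iota (d a).

Section Basis.
Variables (m : nat) (e : 'cV[F]_m).
Hypothesis e_free : forall N : 'M[K]_m, map_mx iota N *m e = 0 -> N = 0.

(** [M] is the matrix of the multiplication by [u] on the [K]-span of the
    entries of [e]. *)
Definition mult_mx (u : F) (M : 'M[K]_m) : Prop := map_mx iota M *m e = u *: e.

Lemma mult_mx_uniq u M N : mult_mx u M -> mult_mx u N -> M = N.
Proof.
rewrite /mult_mx => uM uN; apply/eqP; rewrite -subr_eq0; apply/eqP/e_free.
by rewrite map_mxB mulmxBl uM uN subrr.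
Qed.

Lemma mult_mxC c : mult_mx (iota c) c%:M.
Proof. by rewrite /mult_mx map_scalar_mx mul_scalar_mx. Qed.

Lemma mult_mxD u w M N : mult_mx u M -> mult_mx w N -> mult_mx (u + w) (M + N).
Proof. by rewrite /mult_mx map_mxD mulmxDl scalerDl => -> ->. Qed.

Lemma mult_mxM u w M N : mult_mx u M -> mult_mx w N -> mult_mx (u * w) (M *m N).
Proof.
by rewrite /mult_mx map_mxM -mulmxA => uM ->; rewrite -scalemxAr uM scalerA mulrC.
Qed.

Lemma mult_mxZ c u M : mult_mx u M -> mult_mx (iota c * u) (c *: M).
Proof.
by move=> uM; rewrite -mul_scalar_mx; apply: mult_mxM uM; exact: mult_mxC.
Qed.

Lemma mult_mx_sum n (u : 'I_n -> F) (M : 'I_n -> 'M_m) :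
  (forall i, mult_mx (u i) (M i)) -> mult_mx (\sum_i u i) (\sum_i M i).
Proof.
move=> uM; elim/big_rec2: _ => [|i N w _]; last exact: mult_mxD.
by rewrite /mult_mx map_mx0 mul0mx scale0r.
Qed.

Lemma mult_mx_unit u M : u != 0 -> mult_mx u M -> M \in unitmx.
Proof.
move=> u0 uM; rewrite -row_free_unit -kermx_eq0; apply/eqP/e_free.
apply/(scalerI u0); rewrite scaler0 scalemxAr -uM mulmxA -map_mxM mulmx_ker.
by rewrite map_mx0 mul0mx.
Qed.

Lemma mult_mxV u M : u != 0 -> mult_mx u M -> mult_mx u^-1 (invmx M).
Proof.
move=> u0 uM; have Mu := mult_mx_unit u0 uM.
rewrite /mult_mx; apply/(scalerI u0); rewrite scalerA mulfV// scale1r scalemxAr -uM.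
by rewrite mulmxA -map_mxM mulVmx// map_mx1 mul1mx.
Qed.

Variable A : 'M[K]_m.
Hypothesis derA : map_mx E e = map_mx iota A *m e.

(** Differentiate [M e = u e]: the commutator with [A] accounts for the
    derivatives of the basis [e]. *)
Lemma mult_mx_der u M :
  mult_mx u M -> mult_mx (E u) (map_mx d M + M *m A - A *m M).
Proof.
rewrite /mult_mx => uM; have := congr1 (map_mx E) uM.
have -> : map_mx E (map_mx iota M *m e) =
    map_mx iota (map_mx d M + M *m A) *m e.
  rewrite (map_mx_derM hE) derA mulmxA -map_mxM map_mxD mulmxDl; congr (_ *m _ + _).
  by apply/matrixP => i j; rewrite !mxE Ed.
have -> : map_mx E (u *: e) = E u *: e + map_mx iota (A *m M) *m e.
  rewrite map_mxM -mulmxA uM -scalemxAr -derA.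
  by apply/matrixP => i j; rewrite !mxE derM.
by move=> /eqP; rewrite -subr_eq => /eqP <-; rewrite map_mxB mulmxBl.
Qed.

(** Taking traces turns [E y / y] into the logarithmic derivative of the norm
    of [y]: the commutator with [A] disappears. *)
Lemma trace_relation n (c : 'I_n -> K) (y : 'I_n -> F) (v : F)
    (M : 'I_n -> 'M_m) (V : 'M_m) :
    (forall i, y i != 0) -> (forall i, mult_mx (y i) (M i)) -> mult_mx v V ->
    \sum_i iota (c i) * dlog E (y i) = E v ->
  \sum_i c i * dlog d (\det (M i)) = d (\tr V).
Proof.
move=> y0 yM vV rel.
have uM i : M i \in unitmx by exact: mult_mx_unit (y0 i) (yM i).
have lhs : mult_mx (E v)
    (\sum_i c i *: ((map_mx d (M i) + M i *m A - A *m M i) *m invmx (M i))).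
  rewrite -rel; apply: mult_mx_sum => i; apply: mult_mxZ; apply: mult_mxM.
    exact: mult_mx_der.
  exact: mult_mxV.
have /(congr1 mxtrace) := mult_mx_uniq lhs (mult_mx_der vV).
rewrite raddfB raddfD /= [\tr (A *m V)]mxtrace_mulC addrK -der_tr// => <-.
rewrite raddf_sum; apply: eq_bigr => i _ /=; rewrite mxtraceZ; congr (_ * _).
rewrite dlog_det// mulmxBl mulmxDl raddfB raddfD /=.
by rewrite [\tr (M i *m A *m _)]mxtrace_mulC mulmxA mulVmx// mul1mx mulmxK// addrK.
Qed.

End Basis.

Hypothesis K0 : [pchar K] =i pred0.
Hypothesis algF : forall z : F, algebraicOver iota z.
Local Notation ev q z := ((map_poly iota q).[z]).

(** The powers of [z] below the degree of its minimal polynomial form a basis of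
    [K[z]].  This span is stable under [E] because the derivative of [z] is a
    quotient of two of its elements, and multiplication by a nonzero element is
    invertible on it. *)
Lemma mult_basis z : exists m (e : 'cV[F]_m.+1) (A : 'M[K]_m.+1),
  [/\ forall N : 'M[K]_m.+1, map_mx iota N *m e = 0 -> N = 0,
      map_mx E e = map_mx iota A *m e
    & forall q, exists M, mult_mx e (ev q z) M].
Proof.
have [P [P1 Pz P'z dvdP]] := min_poly_exists K0 algF z.
have [m mP] : exists m, size P = m.+2 by case: (size P) P1 => [|[]] // m; exists m.
pose e := \col_(i < m.+1) z ^+ i : 'cV[F]__.
have evE (q : {poly K}) : (size q <= m.+1)%N ->
    ev q z = \sum_(i < m.+1) iota q`_i * z ^+ i.
  move=> sq; rewrite (@horner_coef_wide _ m.+1) ?size_map_poly//.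
  by apply: eq_bigr => i _; rewrite coef_map.
have e_free (N : 'M[K]_m.+1) : map_mx iota N *m e = 0 -> N = 0.
  move=> Ne; apply/matrixP => i j; rewrite mxE.
  pose q := \poly_(l < m.+1) N i (inord l).
  have : ev q z = 0.
    transitivity ((map_mx iota N *m e) i 0); last by rewrite Ne mxE.
    rewrite evE ?size_poly// mxE.
    by apply: eq_bigr => l _; rewrite !mxE coef_poly ltn_ord inord_val.
  move=> /dvdP /dvdp_leq; rewrite mP => sq.
  have q0 : q = 0.
    by apply/eqP/negPn/negP => /sq; rewrite leqNgt ltnS size_poly.
  by have := coef_poly m.+1 (fun l => N i (inord l)) j;
    rewrite -/q q0 coef0 ltn_ord inord_val.
have evM (q : {poly K}) : exists M, mult_mx e (ev q z) M.
  exists (\matrix_(i, j) ((q * 'X^i) %% P)`_j); apply/matrixP => i j.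
  rewrite !mxE.
  transitivity (ev ((q * 'X^i) %% P) z).
    rewrite evE; last by rewrite -ltnS -mP ltn_modp -size_poly_gt0 mP.
    by apply: eq_bigr => l _; rewrite !mxE.
  transitivity (ev (q * 'X^i) z); last by rewrite rmorphM /= map_polyXn hornerM hornerXn.
  by rewrite [in RHS](divp_eq (q * 'X^i) P) rmorphD rmorphM !hornerE Pz mulr0 add0r.
have Ez : E z = ev (- map_poly d P) z / ev P^`() z.
  have /esym/eqP := der_chain hd z P hE Ed.
  rewrite Pz der0// /chain addrC addr_eq0 mulrC => /eqP PE.
  by apply/(canRL (mulfK P'z)); rewrite PE rmorphN hornerN.
have row_of u : (exists M, mult_mx e u M) ->
    exists r : 'rV[K]_m.+1, u = (map_mx iota r *m e) 0 0.
  move=> [M /matrixP/(_ 0 0)]; rewrite !mxE expr0 mulr1 => <-.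
  by exists (row 0 M); rewrite !mxE; apply: eq_bigr => l _; rewrite !mxE.
have derM : forall i : 'I_m.+1, exists M, mult_mx e (E (z ^+ i)) M.
  move=> i; have -> : z ^+ i = ev 'X^i z by rewrite map_polyXn hornerXn.
  rewrite (der_chain hd _ _ hE Ed) /chain Ez.
  have [M1 ?] := evM (map_poly d 'X^i); have [M2 ?] := evM ('X^i)^`().
  have [M3 ?] := evM (- map_poly d P); have [M4 ?] := evM P^`().
  exists (M1 + M2 *m (M3 *m invmx M4)).
  by do 3?[apply: mult_mxD=> //|apply: mult_mxM => //]; exact: mult_mxV.
have /choice[r rE] : forall i : 'I_m.+1, exists r : 'rV[K]_m.+1,
    E (z ^+ i) = (map_mx iota r *m e) 0 0.
  by move=> i; exact: row_of.
exists m, e, (\matrix_i r i); split=> //.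
apply/matrixP => i j; rewrite !mxE rE !mxE; apply: eq_bigr => l _.
by rewrite !mxE.
Qed.

(** The determinant of the multiplication by [y i] on a simple extension that
    contains all [y i] and [v] is the norm of [y i]; for [y i] in [K] it is a
    power of [y i], with the degree of the extension as exponent. *)
Lemma norm_relation n (c : 'I_n -> K) (y : 'I_n -> F) (v : F) :
    (forall i, y i != 0) -> \sum_i iota (c i) * dlog E (y i) = E v ->
  exists m (N : 'I_n -> K) (w : K),
    [/\ forall i, N i != 0, forall i a, y i = iota a -> N i = a ^+ m.+1
      & \sum_i c i * dlog d (N i) = d w].
Proof.
move=> y0 rel.
have [z0 yz0] := primitive_family K0 algF y.
have [z [[p z0E] [q vE]]] := primitive_pair K0 algF z0 v.
have [m [e [A [e_free derA evM]]]] := mult_basis z.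
have /choice[M yM] : forall i, exists M, mult_mx e (y i) M.
  move=> i; have [r ->] := yz0 i.
  by rewrite z0E -horner_comp -map_comp_poly.
have [V vV] := evM q; rewrite -vE in vV.
exists m, (fun i => \det (M i)), (\tr V); split.
- move=> i; rewrite -unitfE -unitmxE.
  exact: mult_mx_unit e_free _ _ (y0 i) (yM i).
- move=> i a ya; have := yM i; rewrite ya => /(mult_mx_uniq e_free (mult_mxC e a)) <-.
  by rewrite det_scalar.
- exact: trace_relation e_free _ derA _ _ _ _ _ _ y0 yM vV rel.
Qed.

End Trace.

(** * Subfields and fraction fields as types *)

Section SubfieldType.
Variables (F : fieldType) (S : divringClosed F).

Inductive subfield_type := Subfield x & x \in S.
Definition subfield_val u := let: @Subfield x _ := u in x.

HB.instance Definition _ := [isSub for subfield_val].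
HB.instance Definition _ := [Choice of subfield_type by <:].
HB.instance Definition _ :=
  [SubChoice_isSubIntegralDomain of subfield_type by <:].
HB.instance Definition _ := [SubIntegralDomain_isSubField of subfield_type by <:].

End SubfieldType.

(** Makes a subfield given by a predicate available as a field of
    coefficients. *)
Lemma subfield_as_type (F : fieldType) (K : {pred F}) : GRing.divring_closed K ->
  exists (k : fieldType) (iota : {rmorphism k -> F}),
    forall x, x \in K <-> exists a, x = iota a.
Proof.
move=> hK.
pose S : divringClosed F := HB.pack K (GRing.isDivringClosed.Build F K hK).
exists (subfield_type S), (val : {rmorphism subfield_type S -> F}).
move=> x; split=> [xK|[[y yK] ->]] //.
by exists (@Subfield F S x xK).
Qed.

Section FractionLift.
Variables (A : idomainType) (F : fieldType) (phi : {rmorphism A -> F}).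
Hypothesis phi_inj : injective phi.

Let phi0 a : a != 0 -> phi a != 0.
Proof. by rewrite -(inj_eq phi_inj) rmorph0. Qed.

Definition frac_lift (x : {fraction A}) : F :=
  phi \n_(repr x) / phi \d_(repr x).

Lemma frac_lift_div a b : b != 0 -> frac_lift (a%:F / b%:F) = phi a / phi b.
Proof.
move=> b0; rewrite /frac_lift; set x := a%:F / b%:F.
have d0 := denom_neq0 x; have := frac_split x; rewrite {1}/x.
move: (\n_(repr x)) (\d_(repr x)) d0 => n d d0 /eqP.
rewrite eqr_div ?tofrac_eq0// -!tofracM tofrac_eq => /eqP nd.
by apply/eqP; rewrite eq_sym eqr_div ?phi0// -!rmorphM nd.
Qed.

Lemma frac_lift_tofrac a : frac_lift a%:F = phi a.
Proof.
by rewrite -[a%:F]divr1 -tofrac1 frac_lift_div ?oner_neq0// rmorph1 divr1.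
Qed.

Lemma frac_lift_zmod : zmod_morphism frac_lift.
Proof.
move=> x y; have b0 := denom_neq0 x; have d0 := denom_neq0 y.
rewrite (frac_split x) (frac_split y).
move: (\n_(repr x)) (\d_(repr x)) (\n_(repr y)) (\d_(repr y)) b0 d0.
move=> a b c d b0 d0; rewrite -mulNr -tofracN addf_div ?tofrac_eq0//.
rewrite -!tofracM -tofracD !frac_lift_div ?mulf_neq0// -mulNr -rmorphN.
by rewrite addf_div ?phi0// rmorphD !rmorphM.
Qed.

Lemma frac_lift_monoid : monoid_morphism frac_lift.
Proof.
split=> [|x y]; first by rewrite -tofrac1 frac_lift_tofrac rmorph1.
have b0 := denom_neq0 x; have d0 := denom_neq0 y.
rewrite (frac_split x) (frac_split y).
move: (\n_(repr x)) (\d_(repr x)) (\n_(repr y)) (\d_(repr y)) b0 d0.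
move=> a b c d b0 d0; rewrite mulf_div -!tofracM !frac_lift_div ?mulf_neq0//.
by rewrite !rmorphM mulf_div.
Qed.

Lemma frac_lift_exists : exists iota : {rmorphism {fraction A} -> F},
  forall a, iota a%:F = phi a.
Proof.
pose iota : {rmorphism {fraction A} -> F} := HB.pack frac_lift
  (GRing.isZmodMorphism.Build {fraction A} F frac_lift frac_lift_zmod)
  (GRing.isMonoidMorphism.Build {fraction A} F frac_lift frac_lift_monoid).
by exists iota => a; exact: frac_lift_tofrac.
Qed.

End FractionLift.

(** * Making a field algebraic over a rational function field *)

Section MaximalSubring.
Variables (F : fieldType) (t : F).
Implicit Types C : {pred F}.

Definition transcendental C : Prop :=
  forall p : {poly F}, (forall i, p`_i \in C) -> p.[t] = 0 -> p = 0.

(** Zorn's lemma applies because a polynomial over the union of a chain, having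
    finitely many coefficients, is a polynomial over one member of the chain. *)
Lemma maximal_subring C : GRing.subring_closed C -> transcendental C ->
  exists K : {pred F}, [/\ GRing.subring_closed K, {subset C <= K}, transcendental K &
    forall K' : {pred F}, GRing.subring_closed K' -> transcendental K' ->
      {subset K <= K'} -> {subset K' <= K}].
Proof.
move=> hC tC.
pose good (K : F -> bool) :=
  [/\ GRing.subring_closed K, {subset C <= K} & transcendental K].
pose T := {K : F -> bool | good K}.
pose T0 : T := exist good C (And3 hC (fun _ => id) tC).
pose le (K L : T) := `[< {subset sval K <= sval L} >].
have [] := @ZL_preorder T T0 le.
- by move=> K; apply/asboolP.
- by move=> K L M /asboolP KL /asboolP LM; apply/asboolP => x /KL /LM.
- move=> ch tot; have [[K0 chK0]|noch] := pselect (exists K, ch K); last first.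
    by exists T0 => K chK; case: noch; exists K.
  pose U : F -> bool := fun x => `[< exists K, ch K /\ x \in sval K >].
  have Uin K x : ch K -> x \in sval K -> x \in U.
    by move=> chK xK; apply/asboolP; exists K.
  have U2 x y : x \in U -> y \in U -> exists K, [/\ ch K, x \in sval K & y \in sval K].
    move=> /asboolP[K [chK xK]] /asboolP[L [chL yL]].
    have [/asboolP KL|/asboolP LK] := tot _ _ chK chL.
      by exists L; split=> //; exact: KL.
    by exists K; split=> //; exact: LK.
  have hU : GRing.subring_closed U.
    split=> [|x y xU yU|x y xU yU].
    - by apply: (Uin _ _ chK0); case: (svalP K0) => -[].
    - have [K [chK xK yK]] := U2 _ _ xU yU.
      by apply: (Uin _ _ chK); case: (svalP K) => -[_ KB _ _ _]; exact: KB.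
    - have [K [chK xK yK]] := U2 _ _ xU yU.
      by apply: (Uin _ _ chK); case: (svalP K) => -[_ _ KM _ _]; exact: KM.
  have Upoly (p : {poly F}) : (forall i, p`_i \in U) ->
      exists K, ch K /\ forall i, p`_i \in sval K.
    move=> pU.
    suff [K [chK pK]] : exists K, ch K /\ forall i, (i < size p)%N -> p`_i \in sval K.
      exists K; split=> // i; case: (ltnP i (size p)) => [/pK//|/(nth_default _) ->].
      have [[K1 KB _] _ _] := svalP K.
      by rewrite -(subrr 1) KB.
    elim: (size p) => [|n [K [chK pK]]]; first by exists K0.
    have /asboolP[L [chL pL]] := pU n.
    have [/asboolP KL|/asboolP LK] := tot _ _ chK chL.
      exists L; split=> // i; rewrite ltnS leq_eqVlt => /orP[/eqP->//|/pK].
      exact: KL.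
    exists K; split=> // i; rewrite ltnS leq_eqVlt => /orP[/eqP->|/pK//].
    exact: LK.
  have gU : good U.
    split=> //.
      by move=> x xC; apply: (Uin _ _ chK0); case: (svalP K0) => _ CK _; exact: CK.
    move=> p /Upoly[K [_ pK]] pt.
    by case: (svalP K) => _ _ tK; exact: tK.
  by exists (exist _ U gU) => K chK; apply/asboolP => x; exact: Uin.
- move=> [K gK] maxK; case: (gK) => hK CK tK; exists K; split=> // K' hK' tK' KK'.
  have gK' : good K' by split=> // x /CK /KK'.
  by have /asboolP := maxK (exist good K' gK') (introT (asboolP _) KK').
Qed.

Section Maximal.
Variable K : {pred F}.
Hypotheses (hK : GRing.subring_closed K) (tK : transcendental K).
Hypothesis maxK : forall K' : {pred F}, GRing.subring_closed K' -> transcendental K' ->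
  {subset K <= K'} -> {subset K' <= K}.

Lemma maximal_out (K' : {pred F}) x : GRing.subring_closed K' -> {subset K <= K'} ->
  x \in K' -> x \notin K -> exists p : {poly F},
    [/\ forall i, p`_i \in K', p.[t] = 0 & p != 0].
Proof.
move=> hK' KK' xK' xK; apply: contrapT => nop.
have tK' : transcendental K'.
  move=> p pK' pt; apply/eqP/negPn/negP => p0.
  by apply: nop; exists p.
by rewrite (maxK hK' tK' KK' xK') in xK.
Qed.

Let K1 : 1 \in K. Proof. by case: hK. Qed.
Let KB x y : x \in K -> y \in K -> x - y \in K. Proof. by case: hK => ? + _; apply. Qed.
Let KM x y : x \in K -> y \in K -> x * y \in K. Proof. by case: hK => ? _; apply. Qed.
Let KX x n : x \in K -> x ^+ n \in K.
Proof. by move=> xK; elim: n => [//|n IHn]; rewrite exprS KM. Qed.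

(** Clearing denominators: an algebraic relation over [K[1/x]] gives one over
    [K]. *)
Lemma maximal_subring_inv x : x \in K -> x^-1 \in K.
Proof.
move=> xK; have [->|x0] := eqVneq x 0; first by rewrite invr0 -(subrr 1) KB.
apply/negPn/negP => xVK.
pose L : {pred F} := fun u => `[< exists m, x ^+ m * u \in K >].
have LP u : u \in L -> exists m, x ^+ m * u \in K by move/asboolP.
have hL : GRing.subring_closed L.
  split=> [|u v /LP[m um] /LP[n vn]|u v /LP[m um] /LP[n vn]]; apply/asboolP.
  - by exists 0%N; rewrite mulr1 expr0.
  - exists (m + n)%N; rewrite mulrBr {1}addnC !exprD -!mulrA.
    by rewrite KB// KM// KX.
  - exists (m + n)%N; rewrite exprD mulrACA.
    by rewrite KM.
have KL : {subset K <= L} by move=> u uK; apply/asboolP; exists 0%N; rewrite mul1r.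
have xVL : x^-1 \in L by apply/asboolP; exists 1%N; rewrite mulfV.
have [p [pL pt p0]] := maximal_out hL KL xVL xVK.
have /choice[m mP] : forall i : 'I_(size p), exists m, x ^+ m * p`_i \in K.
  by move=> i; exact/LP.
pose M := (\sum_(i < size p) m i)%N.
have pK i : (x ^+ M *: p)`_i \in K.
  rewrite coefZ.
  case: (ltnP i (size p)) => [ip|/(nth_default 0) ->]; last first.
    by rewrite mulr0 -(subrr 1) KB.
  rewrite /M (bigD1 (Ordinal ip))//= exprD mulrAC.
  by rewrite KM// ?KX// (mP (Ordinal ip)).
have /eqP : x ^+ M *: p = 0 by apply: tK pK _; rewrite hornerZ pt mulr0.
by rewrite scaler_eq0 expf_eq0 (negbTE x0) andbF (negbTE p0).
Qed.

Lemma maximal_subring_divring : GRing.divring_closed K.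
Proof. by split=> // x y xK yK; rewrite KM// maximal_subring_inv. Qed.

End Maximal.

(** Over a maximal subfield [k] for which [t] stays transcendental, [F] is
    algebraic over [k(t)]: adjoining [z] to [k] makes [t] algebraic, and the
    relation can be read the other way round. *)
Lemma algebraic_over_rational C : GRing.subring_closed C -> transcendental C ->
  exists (k : fieldType) (iota : {rmorphism {fraction {poly k}} -> F}),
    [/\ iota 'X%:F = t, forall c, c \in C -> exists a, iota (a%:P)%:F = c
      & forall z, algebraicOver iota z].
Proof.
move=> hC tC; have [K [hK CK tK maxK]] := maximal_subring hC tC.
have [k [i iP]] := subfield_as_type (maximal_subring_divring hK tK maxK).
have iK a : i a \in K by apply/iP; exists a.
pose phi : {rmorphism {poly k} -> F} := horner_eval t \o map_poly i.
have phiE p : phi p = (map_poly i p).[t] by [].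
have phi_inj : injective phi.
  apply: raddf_inj => p /eqP pt; apply/eqP; rewrite -(map_poly_eq0 i); apply/eqP.
  by apply: tK (eqP pt) => j; rewrite coef_map; exact: iK.
have [iota iotaE] := frac_lift_exists phi_inj; exists k, iota; split.
- by rewrite iotaE phiE map_polyX hornerX.
- move=> c /CK /iP[a ->]; exists a.
  by rewrite iotaE phiE map_polyC hornerC.
move=> z; have [/iP[a ->]|zK] := boolP (z \in K).
  have -> : i a = iota (a%:P)%:F.
    by rewrite iotaE phiE map_polyC hornerC.
  exact: algebraic_id.
pose L : {pred F} := fun u => `[< exists a, u = (map_poly i a).[z] >].
have hL : GRing.subring_closed L.
  split=> [|u v /asboolP[a ->] /asboolP[b ->]|u v /asboolP[a ->] /asboolP[b ->]].
  - by apply/asboolP; exists 1; rewrite rmorph1 hornerC.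
  - by apply/asboolP; exists (a - b); rewrite rmorphB !hornerE.
  - by apply/asboolP; exists (a * b); rewrite rmorphM !hornerE.
have KL : {subset K <= L}.
  by move=> u /iP[a ->]; apply/asboolP; exists a%:P; rewrite map_polyC hornerC.
have zL : z \in L by apply/asboolP; exists 'X; rewrite map_polyX hornerX.
have [p [pL pt p0]] := maximal_out maxK hL KL zL zK.
have /choice[a aP] : forall j, exists a, p`_j = (map_poly i a).[z].
  by move=> j; have /asboolP := pL j.
pose A := \poly_(j < size p) a j : {poly {poly k}}.
have Ap : map_poly (horner_eval z) (map_poly (map_poly i) A) = p.
  apply/polyP => j; rewrite !coef_map coef_poly /horner_eval /=.
  case: ltnP => sj; first by rewrite aP.
  by rewrite !rmorph0 nth_default.
have A0 : A != 0 by apply: contra_neq p0 => A0; rewrite -Ap A0 !rmorph0.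
exists (map_poly (@tofrac _) (swapXY A)).
  rewrite -size_poly_eq0 size_map_inj_poly ?tofrac0//; last first.
    by move=> x y /eqP; rewrite tofrac_eq => /eqP.
  by rewrite size_poly_eq0 swapXY_eq0.
rewrite /root -map_poly_comp.
have -> : map_poly (iota \o @tofrac _) (swapXY A) =
    map_poly (horner_eval t) (map_poly (map_poly i) (swapXY A)).
  rewrite -map_poly_comp; apply: eq_map_poly => q.
  by rewrite /= iotaE.
rewrite -swapXY_map -horner_swapXY swapXYK.
by rewrite -horner2_swapXY horner_swapXY Ap pt.
Qed.

End MaximalSubring.

(** * Relations between logarithmic derivatives *)

Section LogarithmicRelations.
Variable F : fieldType.
Hypothesis F0 : [pchar F] =i pred0.

Definition der_over (C : {pred F}) (E : F -> F) : Prop :=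
  leibniz E /\ forall c, c \in C -> E c = 0.

Lemma pchar0_of_rmorphism (k : fieldType) (i : {rmorphism k -> F}) :
  [pchar k] =i pred0.
Proof.
apply/pcharf0P => n; have /pcharf0P <- := F0.
by rewrite -(rmorph_nat i) fmorph_eq0.
Qed.

(** Extend [d/dt], for [t = y ord0], to [F]; take norms down to [k(t)] and then
    residues at the origin.  The integers are the orders of the norms of the
    [y i], and the norm of [t] is a power of [t]. *)
Lemma integer_relation (C : {pred F}) n (c y : 'I_n.+1 -> F) (v : F) :
    GRing.subring_closed C -> (forall i, c i \in C) ->
    (forall i, y i != 0) -> transcendental (y ord0) C ->
    (forall E, der_over C E -> \sum_i c i * dlog E (y i) = E v) ->
  exists m : 'I_n.+1 -> int, m ord0 != 0 /\ \sum_i c i * (m i)%:~R = 0.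
Proof.
move=> hC cC y0 ty rel.
have [k [iota [iX iC alg]]] := algebraic_over_rational hC ty.
have K0 := pchar0_of_rmorphism iota.
have k0 : [pchar k] =i pred0.
  apply/pcharf0P => n1; have /pcharf0P <- := K0.
  by rewrite -(rmorph_nat (@tofrac {poly k} \o polyC)) /= tofrac_eq0 polyC_eq0.
pose d := fder (@deriv k).
have hd : leibniz d := leibniz_fder (leibniz_deriv k).
have dF (p : {poly k}) : d p%:F = (p^`())%:F.
  by case: (leibniz_deriv k) => ? ?; exact: fder_tofrac.
have [E [hE Ed]] := leibniz_extension K0 alg hd.
have EC : der_over C E.
  split=> // _ /iC[a <-].
  by rewrite Ed dF derivC tofrac0 rmorph0.
have /choice[a aE] : forall i, exists a, iota (a%:P)%:F = c i.
  by move=> i; exact: iC.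
have {}rel : \sum_i iota ((a i)%:P)%:F * dlog E (y i) = E v.
  by rewrite -rel//; apply: eq_bigr => i _; rewrite aE.
have [m [N [w [N0 Npow {}rel]]]] := norm_relation hd hE Ed K0 alg y0 rel.
have NX : N ord0 = ('X%:F) ^+ m.+1 by apply: Npow; rewrite iX.
have /choice[o oP] : forall i, exists o : int,
    value0 ('X%:F * dlog d (N i)) (o%:~R : k).
  by move=> i; have [o [? _ _]] := order0 (N0 i); exists o.
exists o; split.
  apply/negP => /eqP o0; have := oP ord0; rewrite o0 NX.
  have X0 : 'X%:F != 0 :> {fraction {poly k}} by rewrite tofrac_eq0 polyX_eq0.
  rewrite (dlogX hd _ X0) mulrCA /dlog dF derivX tofrac1 mul1r mulfV//.
  have -> : m.+1%:R * 1 = (m.+1%:R%:P)%:F :> {fraction {poly k}}.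
    by rewrite mulr1 !rmorph_nat.
  move=> /value0_uniq/(_ (value0C _)); rewrite mulr0z => /esym/eqP.
  by have /pcharf0P -> := k0.
have : value0 ('X%:F * d w) (\sum_i a i * (o i)%:~R).
  rewrite -rel mulr_sumr; apply: value0_sum => i; rewrite mulrCA.
  by apply: value0M; [exact: value0C|exact: oP].
pose j : {rmorphism k -> F} := iota \o @tofrac _ \o polyC.
move=> /(value0_exact k0)/(congr1 j); rewrite rmorph0 rmorph_sum => j0.
rewrite -[RHS]j0; apply: eq_bigr => i _.
by rewrite rmorphM rmorph_int -aE.
Qed.

Section ConstantField.
Variable C : {pred F}.
Hypothesis hC : GRing.divring_closed C.
Hypothesis closedC : forall u, u \notin C -> transcendental u C.

(** An integer relation [\sum_i m i * c i = 0] with [m 0 != 0] eliminates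
    [c 0]: what remains is a relation between the logarithmic derivatives of
    the elements [y i ^ m 0 / y 0 ^ m i] for [i > 0], which are again
    multiplicatively independent. *)
Lemma log_independence n (c y : 'I_n -> F) (v : F) :
    (forall i, c i \in C) -> (forall i, y i != 0) -> mult_indep_mod C y ->
    (forall E, der_over C E -> \sum_i c i * dlog E (y i) = E v) ->
  forall i, c i = 0.
Proof.
elim: n c y v => [|n IHn] c y v cC y0 yind rel; first by case.
have yC : y ord0 \notin C.
  apply/negP => yC; pose k (i : 'I_n.+1) : int := if i == ord0 then 1 else 0.
  have := yind k; rewrite (_ : \prod_i _ = y ord0); last first.
    rewrite big_ord_recl big1 => [|i _]; last exact: expr0z.
    by rewrite /k eqxx expr1z mulr1.
  by move=> /(_ yC (y0 _) ord0); rewrite /k eqxx.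
have [m [m0 mc]] := integer_relation hC cC y0 (closedC yC) rel.
pose y' i := y (lift ord0 i) ^ m ord0 * y ord0 ^ (- m (lift ord0 i)).
have y'0 i : y' i != 0 by rewrite mulf_neq0 ?expfz_neq0.
have yind' : mult_indep_mod C y'.
  move=> k; set p := \prod_i y' i ^ k i => /= pC p0 i.
  (* The exponents of [p] as a product of powers of the original [y j]. *)
  pose k' j := if unlift ord0 j is Some i then m ord0 * k i
    else - \sum_i m (lift ord0 i) * k i.
  have pE : \prod_j y j ^ k' j = p.
    rewrite big_ord_recl /k' unlift_none -sumrN.
    have expz_sum (x : F) (e : 'I_n -> int) : x != 0 ->
        x ^ (\sum_i e i) = \prod_i x ^ e i.
      move=> x0; elim/big_rec2: _ => [|j a b _ <-]; first by rewrite expr0z.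
      by rewrite expfzDr.
    rewrite expz_sum// -big_split; apply: eq_bigr => j _.
    by rewrite liftK /y' exprzMl ?unitfE ?expfz_neq0// !exprz_exp mulNr [LHS]mulrC.
  have := yind k'; rewrite /= pE => /(_ pC p0 (lift ord0 i)).
  rewrite /k' liftK => /eqP; rewrite mulf_eq0 (negbTE m0) => /eqP.
  exact.
have c'0 : forall i, c (lift ord0 i) = 0.
  apply: (IHn _ y' ((m ord0)%:~R * v)) => // E EC; have [hE _] := EC.
  have dlogE i : dlog E (y' i) = (m ord0)%:~R * dlog E (y (lift ord0 i)) -
      (m (lift ord0 i))%:~R * dlog E (y ord0).
    by rewrite dlogM ?expfz_neq0// !dlogXz// rmorphN mulNr.
  under eq_bigr do rewrite dlogE mulrBr.
  rewrite sumrB derM// der_int// mul0r add0r -rel// [in RHS]big_ord_recl mulrDr.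
  rewrite addrC; congr (_ + _).
    have /eqP := mc; rewrite big_ord_recl addr_eq0 mulrCA mulrA => /eqP ->.
    rewrite mulNr mulr_suml; congr (- _); apply: eq_bigr => i _.
    by rewrite !mulrA.
  by rewrite mulr_sumr; apply: eq_bigr => i _; rewrite mulrCA.
move=> i; have [j ->|->] := unliftP ord0 i; first exact: c'0.
move: mc; rewrite big_ord_recl big1 => [|j _]; last by rewrite c'0 mul0r.
move/eqP; rewrite addr0 mulf_eq0 intr_eq0_pchar0// (negbTE m0) orbF.
by move/eqP.
Qed.

End ConstantField.
End LogarithmicRelations.

(** * Algebraic independence from derivations *)

Section Jacobian.
Variables (F : fieldType) (C : {pred F}).
Hypothesis F0 : [pchar F] =i pred0.
Hypothesis hC : GRing.divring_closed C.

Let CB x y : x \in C -> y \in C -> x - y \in C. Proof. by case: hC => ? + _; apply. Qed.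
Let C0 : 0 \in C. Proof. by case: hC => C1 _ _; rewrite -(subrr 1) CB. Qed.
Let CD x y : x \in C -> y \in C -> x + y \in C.
Proof. by move=> xC yC; rewrite -[y]opprK CB// -[- y]add0r CB. Qed.

Section Chain.
Variables (m : nat) (z : 'I_m -> F) (E : F -> F).
Hypothesis EC : der_over C E.

Let hE : leibniz E. Proof. by case: EC. Qed.

Definition chain_rule (p : mpoly m F) : Prop :=
  E (meval z p) = \sum_k meval z (mderiv k p) * E (z k).

Lemma chain_ruleM p q : chain_rule p -> chain_rule q -> chain_rule (p * q).
Proof.
rewrite /chain_rule => pE qE.
rewrite rmorphM derM// pE qE mulr_suml mulr_sumr -big_split.
apply: eq_bigr => k _ /=.
by rewrite mderivM rmorphD !rmorphM /=; ring.
Qed.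

Lemma chain_ruleX i : chain_rule (mpolyX F (mnm1 i)).
Proof.
rewrite /chain_rule mevalXU (bigD1 i)//= big1 => [|k /negbTE ki].
  by rewrite addr0 mderivX mnm1E eqxx scale1r -[X in mnm_sub X _](add0m) addmK
    mpolyX0 rmorph1 mul1r.
by rewrite mderivX mnm1E eq_sym ki scale0r rmorph0 mul0r.
Qed.

Lemma chain_rule_coeff p : (forall mu, mcoeff mu p \in C) -> chain_rule p.
Proof.
have chain_rule1 : chain_rule 1.
  rewrite /chain_rule rmorph1 der1// big1// => k _.
  by rewrite -mpolyC1 mderivC rmorph0 mul0r.
move=> pC; rewrite [p]mpolyE.
elim/big_ind: _ => [|q r qE rE|mu _].
- rewrite /chain_rule rmorph0 der0// big1// => k _.
  by rewrite mderiv0 rmorph0 mul0r.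
- rewrite /chain_rule rmorphD derD// qE rE -big_split; apply: eq_bigr => k _ /=.
  by rewrite mderivD rmorphD mulrDl.
- have : chain_rule (mpolyX F mu).
    rewrite mpolyXE_id; elim/big_ind: _ => [//||i _]; first exact: chain_ruleM.
    elim: (mu i) => [|a IHa]; first by rewrite expr0.
    by rewrite exprS; apply: chain_ruleM IHa; exact: chain_ruleX.
  rewrite /chain_rule mevalZ derM// => ->.
  case: EC => _ -> //; rewrite mul0r add0r mulr_sumr; apply: eq_bigr => k _.
  by rewrite mderivZ mevalZ mulrA.
Qed.

End Chain.

Lemma mpolyOver_coeff m (p : mpoly m F) : p \is a mpolyOver m C ->
  forall mu, mcoeff mu p \in C.
Proof.
move=> /allP pC mu; have [mup|/memN_msupp_eq0 ->//] := boolP (mu \in msupp p).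
exact/pC/map_f.
Qed.

(** The Jacobian criterion: a nontrivial relation of least degree would have
    all its partial derivatives in the kernel of an invertible matrix. *)
Lemma alg_indep_jacobian m (z : 'I_m -> F) (E : 'I_m -> F -> F) :
    (forall j, der_over C (E j)) -> (\matrix_(j, k) E j (z k)) \in unitmx ->
  alg_indep C z.
Proof.
move=> EC uJ p /mpolyOver_coeff.
have [n pn] : exists n, (mmeasure mdeg p <= n)%N by exists (mmeasure mdeg p).
elim: n p pn => [|n IHn] p pn pC pz.
  by apply/eqP; rewrite -msize_poly_eq0 -leqn0.
have dp k : mderiv k p = 0.
  apply: IHn => [|mu|].
  - rewrite msizeE; apply/bigmax_leqP_seq => mu; rewrite mcoeff_msupp mcoeff_deriv.
    move=> mup _; rewrite -ltnS; apply: leq_trans pn.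
    rewrite -(addn1 (mdeg mu)) -(mdeg1 k) -mdegD; apply: msize_mdeg_lt.
    by rewrite mcoeff_msupp; apply: contraNneq mup => ->; rewrite mul0rn.
  - rewrite mcoeff_deriv; elim: (mu k).+1 => [|a IHa]; first by rewrite mulr0n.
    by rewrite mulrS CD.
  - pose v := \col_k meval z (mderiv k p).
    have : (\matrix_(j, k) E j (z k)) *m v = 0.
      apply/matrixP => j l; rewrite !mxE.
      transitivity (E j (meval z p)); last first.
        by rewrite pz der0//; case: (EC j).
      rewrite (chain_rule_coeff z (EC j) pC); apply: eq_bigr => i _.
      by rewrite !mxE mulrC.
    move=> /(congr1 (mulmx (invmx (\matrix_(j, k) E j (z k))))).
    by rewrite mulKmx// mulmx0 => /matrixP/(_ k 0); rewrite !mxE.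
have p0 mu : mu != mnm0 -> mcoeff mu p = 0.
  move=> mu0; have [i mui] : exists i, (0 < mu i)%N.
    apply/existsP; apply: contraNT mu0; rewrite negb_exists => /forallP mui.
    by apply/eqP/mnmP => i; rewrite mnm0E; apply/eqP; have := mui i; rewrite lt0n negbK.
  have := mcoeff_deriv i (mnm_sub mu (mnm1 i)) p.
  rewrite dp mcoeff0 submK; last first.
    by apply/mnm_lepP => l; rewrite mnm1E; case: eqP => // <-.
  move/esym/eqP; rewrite -mulr_natr mulf_eq0 => /orP[/eqP//|].
  by have /pcharf0P -> := F0.
have pE : p = mpolyC m (mcoeff mnm0 p).
  apply/mpolyP => mu; rewrite mcoeffC; have [->|mu0] := eqVneq mu mnm0.
    by rewrite mulr1.
  by rewrite p0// mulr0.
by move: (mcoeff mnm0 p) pE pz => a ->; rewrite mevalC => ->; rewrite mpolyC0.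
Qed.
End Jacobian.

(** * The field of constants of a set of derivations *)

Section Constants.
Variables (F : fieldType) (Delta : set (F -> F)) (C : {pred F}).
Hypothesis F0 : [pchar F] =i pred0.
Hypothesis hDelta : forall D, Delta D -> leibniz D.
Hypothesis CP : forall x, x \in C <-> forall D, Delta D -> D x = 0.

Lemma constants_divring : GRing.divring_closed C.
Proof.
split=> [|x y /CP xC /CP yC|x y /CP xC /CP yC]; apply/CP => D DD.
- exact/der1/hDelta.
- by rewrite derB ?xC ?yC ?subrr//; exact: hDelta.
- have hD := hDelta DD; rewrite derM// xC// mul0r add0r.
  have [->|y0] := eqVneq y 0; first by rewrite invr0 der0// mulr0.
  by rewrite derV// yC// oppr0 mul0r mulr0.
Qed.

(** In characteristic zero, differentiating an equation of least degree shows
    that every element algebraic over the constants is a constant. *)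
Lemma constants_closed u : u \notin C -> transcendental u C.
Proof.
move=> uC; have [D [DD Du]] : exists D, Delta D /\ D u != 0.
  apply: contrapT => noD; case/negP: uC; apply/CP => D DD.
  by apply/eqP/negPn/negP => Du; apply: noD; exists D.
have hD := hDelta DD.
have chain_rule (p : {poly F}) : (forall i, p`_i \in C) ->
    D p.[u] = p^`().[u] * D u.
  elim/poly_ind: p => [|p c IHp] pC; first by rewrite deriv0 !horner0 der0// mul0r.
  have pC' i : p`_i \in C by have := pC i.+1; rewrite coefD coefMX coefC addr0.
  have cC : c \in C by have := pC 0%N; rewrite coefD coefMX coefC add0r.
  rewrite derivD derivM derivX derivC addr0 mulr1 !hornerE derD// derM// IHp//.
  by move/CP: cC => ->//; ring.
move=> p; have [n] := ubnP (size p); elim: n p => [//|n IHn] p.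
rewrite ltnS => pn pC pu.
have p'0 : p^`() = 0.
  have [->|p0] := eqVneq p 0; first exact: deriv0.
  apply: IHn => [|i|].
  - by apply: leq_trans pn; exact: lt_size_deriv.
  - apply/CP => E EE; rewrite coef_deriv -mulr_natr derM; last exact: hDelta.
    have /CP -> // := pC i.+1.
    by have := der_int (hDelta EE) i.+1; rewrite -pmulrn => ->; rewrite mul0r mulr0 addr0.
  - have /eqP := chain_rule _ pC; rewrite pu der0// eq_sym mulf_eq0 (negbTE Du) orbF.
    by move/eqP.
have pE : p = (p`_0)%:P.
  apply/polyP => -[|i]; first by rewrite coefC.
  rewrite coefC /=; have := coef_deriv p i; rewrite p'0 coef0 => /esym/eqP.
  rewrite -mulr_natr mulf_eq0; have /pcharf0P -> := F0.
  by rewrite orbF => /eqP.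
by move: (p`_0) pE pu => a ->; rewrite hornerC => ->.
Qed.

Lemma der_over_Delta D : Delta D -> der_over C D.
Proof. by move=> DD; split=> [|c /CP ->//]; exact: hDelta. Qed.

Lemma der_over_bracket D E : Delta D -> der_over C E ->
  der_over C (fun x => D (E x) - E (D x)).
Proof.
move=> DD [hE EC]; have hD := hDelta DD; split; [split|] => [x y|x y|c cC].
- by rewrite (derD hE) !(derD hD) (derD hE); ring.
- by rewrite (derM hE) !(derM hD, derD hD) !(derD hE, derM hE); ring.
- have Dc : D c = 0 by move/CP: cC; exact.
  by rewrite Dc EC// (der0 hD) (der0 hE) subrr.
Qed.

Section ExponentialFamily.
Variables (n : nat) (x y : 'I_n -> F).
Hypothesis y0 : forall i, y i != 0.
Hypothesis Dy : forall D i, Delta D -> D (y i) = y i * D (x i).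

(** The value on [E] of the differential form [dx_i - dy_i / y_i]. *)
Definition exp_form (E : F -> F) (i : 'I_n) : F := E (x i) - dlog E (y i).

Lemma exp_form_Delta D i : Delta D -> exp_form D i = 0.
Proof. by move=> DD; rewrite /exp_form /dlog Dy// mulrC mulKf// subrr. Qed.

(** The forms are killed by the Lie derivative along [D]: [dy_i / y_i] has
    Lie derivative [d (D (y i) / y i)], which is [d (D (x i))]. *)
Lemma exp_form_bracket D E i : Delta D -> leibniz E ->
  D (exp_form E i) = exp_form (fun z => D (E z) - E (D z)) i.
Proof.
move=> DD hE; have hD := hDelta DD.
rewrite /exp_form /dlog (Dy _ DD) (derB hD) (derM hD) (derV hD)// (derM hE) (Dy _ DD).
by have := y0 i; move: (y i) => b b0; field.
Qed.

(** A shortest relation has constant coefficients, since [D] maps it to a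
    shorter one, and a relation with constant coefficients contradicts
    [log_independence]. *)
Lemma exp_form_independence (a : 'I_n -> F) : mult_indep_mod C y ->
    (forall E, der_over C E -> \sum_i a i * exp_form E i = 0) ->
  forall i, a i = 0.
Proof.
move=> yind; have [k] := ubnP #|[pred i | a i != 0]|.
elim: k a => [//|k IHk] a ak rel; apply: contrapT => /existsNP[i0 /eqP ai0].
pose b i := a i / a i0.
have brel E : der_over C E -> \sum_i b i * exp_form E i = 0.
  move=> /rel aE; transitivity ((a i0)^-1 * \sum_i a i * exp_form E i).
    rewrite mulr_sumr; apply: eq_bigr => i _; rewrite /b; ring.
  by rewrite aE mulr0.
have bi0 : b i0 = 1 by rewrite /b mulfV.
have bC i : b i \in C.
  apply/CP => D DD; have hD := hDelta DD; move: i.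
  apply: (IHk (fun i => D (b i))).
    move: ak; rewrite ltnS; apply: leq_trans; apply: proper_card.
    apply/properP; split.
      apply/fintype.subsetP => i; rewrite !inE; apply: contraNneq => ai.
      by rewrite /b ai mul0r der0.
    by exists i0; rewrite !inE ?ai0// bi0 der1// eqxx.
  move=> E EC; have [hE _] := EC.
  pose DE z := D (E z) - E (D z).
  transitivity (D (\sum_i b i * exp_form E i) - \sum_i b i * exp_form DE i).
    rewrite (der_sum hD) -sumrB; apply: eq_bigr => i _.
    by rewrite [in RHS](derM hD) (exp_form_bracket _ DD hE) addrK.
  by rewrite !brel ?(der0 hD) ?subrr//; exact: der_over_bracket.
have : b i0 = 0.
  apply: (log_independence F0 constants_divring constants_closed bC y0 yind
    (v := \sum_i b i * x i)).
  move=> E EC; have [hE E0] := EC; apply/eqP; rewrite eq_sym -subr_eq0.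
  rewrite (der_sum hE) -sumrB; apply/eqP; rewrite -[RHS](brel E EC).
  apply: eq_bigr => i _; rewrite (derM hE) E0// mul0r add0r.
  by rewrite /exp_form mulrBr.
by move/eqP; rewrite bi0 oner_eq0.
Qed.

End ExponentialFamily.
End Constants.

(** * Ax's theorem for fields with derivations *)

(** A free family of fewer than [n] rows is annihilated by some nonzero column
    [a]; a row of the family [w] that [a] does not annihilate extends it. *)
Lemma full_rank_rows (F : fieldType) (I : Type) (T : set I) n (w : I -> 'I_n -> F) :
    (forall a : 'I_n -> F, (forall t, T t -> \sum_i a i * w t i = 0) ->
       forall i, a i = 0) ->
  exists t : 'I_n -> I, (forall j, T (t j)) /\ row_free (\matrix_(j, i) w (t j) i).
Proof.
move=> ann.
suff ext r : (r <= n)%N -> exists t : 'I_r -> I,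
    (forall j, T (t j)) /\ row_free (\matrix_(j, i) w (t j) i).
  exact: ext.
elim: r => [_|r IHr rn].
  have t : 'I_0 -> I by case.
  by exists t; split=> [[]//|]; rewrite /row_free -leqn0 rank_leq_row.
have [t [Tt free]] := IHr (ltnW rn).
set M := \matrix_(j, i) w (t j) i in free.
have [a [a0 Ma]] : exists a : 'cV[F]_n, a != 0 /\ M *m a = 0.
  have : kermx M^T != 0.
    by rewrite kermx_eq0 /row_free mxrank_tr (eqP free) neq_ltn rn.
  move=> /rowV0Pn[v /sub_kermxP vM v0]; exists v^T.
  by rewrite trmx_eq0 v0 -[M]trmxK -trmx_mul vM trmx0.
have [s [Ts sa]] : exists s, T s /\ \sum_i a i 0 * w s i != 0.
  apply: contrapT => nos; case/negP: a0; apply/eqP/matrixP => i j.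
  rewrite ord1 mxE; apply: (ann (fun i => a i 0)) => s Ts.
  by apply/eqP/negPn/negP => sa; apply: nos; exists s.
exists (fun j => if unlift ord0 j is Some j' then t j' else s).
split=> [j|]; first by case: unlift.
apply: inj_row_free => u uM.
have u00 : u 0 0 = 0.
  have : (u *m (\matrix_(j, i) w (if unlift ord0 j is Some j' then t j' else s) i)
      *m a) 0 0 = 0 by rewrite uM mul0mx mxE.
  rewrite -mulmxA mxE big_ord_recl big1 => [|j _].
    rewrite addr0 !mxE => /eqP; rewrite mulf_eq0 => /orP[/eqP//|].
    by under eq_bigr do rewrite mxE unlift_none mulrC; rewrite (negbTE sa).
  have /matrixP/(_ j 0) := Ma; rewrite !mxE => Maj.
  rewrite -[RHS](mulr0 (u 0 (lift ord0 j))).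
  congr (_ * _); rewrite -[RHS]Maj ?[LHS]mxE.
  by apply: eq_bigr => i _; rewrite !mxE liftK.
have uM' : (\row_j u 0 (lift ord0 j)) *m M = 0.
  apply/matrixP => l i; have /matrixP/(_ 0 i) := uM.
  rewrite !mxE big_ord_recl u00 mul0r add0r => uMi; rewrite -[RHS]uMi.
  by apply: eq_bigr => j _; rewrite !mxE liftK.
have {}uM' : \row_j u 0 (lift ord0 j) = 0.
  by apply: (row_free_inj free); rewrite uM' mul0mx.
apply/rowP => j; rewrite mxE; have [j' ->|->//] := unliftP ord0 j.
by have /rowP/(_ j') := uM'; rewrite !mxE.
Qed.

(** Ax's theorem.  Choose derivations [E j] on which the matrix of the forms is
    invertible.  In a relation between the values of the [E j] and [t j] on the
    [x i] and [y i], applying the forms, which vanish on the [t j], kills the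
    coefficients of the [E j]; the others vanish by the hypothesis on [t].  So
    the matrix of these values has rank [n + r], and any [n + r] independent
    columns of it select algebraically independent elements. *)
Theorem ax_schanuel (F : fieldType) (Delta : set (F -> F)) (C : {pred F})
    (n r : nat) (x y : 'I_n -> F) (t : 'I_r -> F -> F) :
    [pchar F] =i pred0 -> (forall D, Delta D -> leibniz D) ->
    (forall u, u \in C <-> forall D, Delta D -> D u = 0) ->
    (forall i, y i != 0) ->
    (forall D i, Delta D -> D (y i) = y i * D (x i)) ->
    mult_indep_mod C y ->
    (forall j, Delta (t j)) -> row_free (\matrix_(j, i) t j (x i)) ->
  exists z : 'I_(n + r) -> F, alg_indep C z /\
    forall k, (exists i, z k = x i) \/ (exists i, z k = y i).
Proof.
move=> F0 hDelta CP y0 Dy yind Dt tfree.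
have [E [EC Efree]] := full_rank_rows
  (exp_form_independence F0 hDelta CP y0 Dy ^~ yind).
pose G (j : 'I_(n + r)) := match fintype.split j with inl j => E j | inr j => t j end.
pose u (k : 'I_(n + n)) := match fintype.split k with inl i => x i | inr i => y i end.
have Gl j : G (lshift r j) = E j by rewrite /G (unsplitK (inl _)).
have Gr j : G (rshift n j) = t j by rewrite /G (unsplitK (inr _)).
have ul i : u (lshift n i) = x i by rewrite /u (unsplitK (inl _)).
have ur i : u (rshift n i) = y i by rewrite /u (unsplitK (inr _)).
have GC j : der_over C (G j).
  rewrite /G; case: (fintype.split j) => j'; first exact: EC.
  exact: (der_over_Delta hDelta CP).
pose N := \matrix_(j, k) G j (u k).
have Nfree : row_free N.
  apply: inj_row_free => v vN.
  have vx i : \sum_j v 0 j * G j (x i) = 0.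
    have /rowP/(_ (lshift n i)) := vN; rewrite !mxE => vNi; rewrite -[RHS]vNi.
    by apply: eq_bigr => j _; rewrite !mxE ul.
  have vy i : \sum_j v 0 j * G j (y i) = 0.
    have /rowP/(_ (rshift n i)) := vN; rewrite !mxE => vNi; rewrite -[RHS]vNi.
    by apply: eq_bigr => j _; rewrite !mxE ur.
  have vform i : \sum_j v 0 j * exp_form x y (G j) i = 0.
    transitivity (\sum_j v 0 j * G j (x i) - (\sum_j v 0 j * G j (y i)) / y i).
      rewrite mulr_suml -sumrB; apply: eq_bigr => j _.
      by rewrite /exp_form /dlog mulrBr mulrA.
    by rewrite vx vy mul0r subr0.
  have vl : lsubmx v = 0.
    apply: (row_free_inj Efree); rewrite mul0mx; apply/rowP => i.
    rewrite !mxE -[RHS](vform i) big_split_ord /= [X in _ + X]big1 ?addr0 => [|j _].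
      by apply: eq_bigr => j _; rewrite !mxE Gl.
    by rewrite Gr (exp_form_Delta y0 Dy) ?mulr0.
  have vl0 j : v 0 (lshift r j) = 0 by have /rowP/(_ j) := vl; rewrite !mxE.
  have vr : rsubmx v = 0.
    apply: (row_free_inj tfree); rewrite mul0mx; apply/rowP => i.
    rewrite !mxE -[RHS](vx i) big_split_ord /= [X in X + _]big1 ?add0r => [|j _].
      by apply: eq_bigr => j _; rewrite !mxE Gr.
    by rewrite vl0 mul0r.
  by rewrite -[v]hsubmxK vl vr row_mx0.
have Nfull : row_full N^T by rewrite /row_full mxrank_tr.
pose z k := u (fullrankfun Nfull k).
exists z; split; last first.
  move=> k; rewrite /z /u; case: (fintype.split _) => i; [left|right]; by exists i.
apply: (alg_indep_jacobian F0 (constants_divring hDelta CP) GC).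
rewrite -unitmx_tr; have := fullrowsub_unit Nfull.
by congr (_ \in unitmx); apply/matrixP => k j; rewrite !mxE.
Qed.

(** * The exponential of an arithmetic function *)

Section ArithmeticExponential.
Variable R : realType.
Implicit Types f g h : arith R.

Lemma arith_hausdorff : hausdorff_space (arith R).
Proof. exact: (@metric_hausdorff R (arith R)). Qed.

(** Agreement below [M] bounds the norm of the difference by [1 / M]. *)
Lemma arith_cvg (u : nat -> arith R) (l : arith R) :
    (forall M, exists N0, forall N, (N0 <= N)%N ->
       forall n, (n < M)%N -> u N n = l n) ->
  u @ \oo --> l.
Proof.
move=> ul; apply/cvg_ballP => e e0.
have [N0 uN] := ul (Num.bound e^-1).+1.
exists N0 => // N /= /uN uNl; rewrite ballEmdist /= -[mdist _ _]/(anorm (l - u N)) /anorm.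
have [->|luN0] := eqVneq (l - u N) 0; first by rewrite aorder0 invr0.
rewrite invf_plt ?posrE ?ltr0n ?aorder_gt0//.
have e1 : e^-1 < (Num.bound e^-1)%:R by apply: archi_boundP; rewrite invr_ge0 ltW.
apply: lt_le_trans e1 _; rewrite ler_nat leqNgt; apply/negP => lt.
have := aorder_neq0 luN0; rewrite aaddE aoppE uNl ?subrr ?eqxx//.
exact: leq_trans lt _.
Qed.

(** Only factorizations of [n] into [k] factors that are at least 2 contribute
    to the value at [n]. *)
Lemma exp_vanish g k n : g 1%N = 0 -> (n < 2 ^ k)%N -> (g ^+ k) n = 0.
Proof.
move=> g1; elim: k n => [|k IHk] [|n] nk; rewrite ?arith0//.
rewrite exprS amulE big_seq big1// => d; rewrite -dvdn_divisors// => dn.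
have [->|d1] := eqVneq d 1%N; first by rewrite g1 mul0r.
have d0 : (0 < d)%N by apply: dvdn_gt0 dn.
rewrite IHk ?mulr0// ltn_divLR//; apply: leq_trans nk _.
by rewrite expnSr leq_mul2l ltn_neqAle [1%N == d]eq_sym d1 d0 orbT.
Qed.

Local Notation exp_term g := (fun k => (k`!%:R^-1 : R[i]) *: (g : arith R) ^+ k).

Lemma arith_sumE I (r : seq I) (P : pred I) (G : I -> arith R) n :
  (\sum_(i <- r | P i) G i) n = \sum_(i <- r | P i) G i n.
Proof. exact: (big_morph (fun f : arith R => f n)). Qed.

Lemma exp_series_stationary g n N : g 1%N = 0 -> (n < N)%N ->
  series (exp_term g) N n = series (exp_term g) n.+1 n.
Proof.
move=> g1 nN; rewrite /series /= !arith_sumE.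
rewrite (big_cat_nat _ nN)//= -[RHS]addr0; congr (_ + _).
rewrite big_nat big1// => k /andP[nk _].
rewrite exp_vanish ?mulr0//.
exact: leq_trans nk (ltnW (ltn_expl k (ltnSn 1))).
Qed.

Lemma exp_limit_vanish0 g : vanish0 (fun n => series (exp_term g) n.+1 n).
Proof. by rewrite /vanish0 arith0. Qed.

Lemma exp_limit_cvg g : g 1%N = 0 ->
  series (exp_term g) @ \oo --> Arith (exp_limit_vanish0 g).
Proof.
move=> g1; apply: arith_cvg => M; exists M => N MN n nM /=.
by apply: exp_series_stationary => //; exact: leq_trans MN.
Qed.

Lemma Exp0_limit g : g 1%N = 0 -> Exp0 g = Arith (exp_limit_vanish0 g).
Proof. by move=> /exp_limit_cvg/(cvg_lim arith_hausdorff). Qed.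

Lemma Exp0_cvg g : g 1%N = 0 -> series (exp_term g) @ \oo --> Exp0 g.
Proof. by move=> g1; rewrite Exp0_limit//; exact: exp_limit_cvg. Qed.

Lemma Exp0E g n N : g 1%N = 0 -> (n < N)%N -> Exp0 g n = series (exp_term g) N n.
Proof. by move=> g1 nN; rewrite exp_series_stationary// Exp0_limit. Qed.

Lemma cexp_neq0 (a : R[i]) : cexp a != 0.
Proof.
rewrite mulf_neq0//.
  by rewrite eq_complex /= negb_and gt_eqF ?expR_gt0.
apply/eqP => -[c0 s0]; have /eqP := cos2Dsin2 (complex.Im a).
by rewrite c0 s0 expr0n addr0 eq_sym oner_eq0.
Qed.

Lemma Exp_neq0 f : Exp f != 0.
Proof.
apply/eqP => /(congr1 (fun h : arith R => h 1%N)).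
have g1 : (f - (f 1%N)%:A) 1%N = 0 by rewrite aaddE aoppE aconstE eqxx subrr.
rewrite /Exp mulr_algl ascaleE (@Exp0E _ _ 2)// /series /= arith_sumE.
rewrite !big_nat_recl// big_geq// !ascaleE expr0 expr1 g1 mulr0 !addr0.
rewrite fact0 invr1 mul1r /= mulr1; apply/eqP; exact: cexp_neq0.
Qed.

Section Derivation.
Variable D : arith R -> arith R.
Hypotheses (hD : derivation D) (cD : continuous D).

Lemma derivation_leibniz : leibniz D.
Proof.
by case: hD => linD DM; split=> // f g; have := linD 1 f g; rewrite !scale1r.
Qed.

Let hL := derivation_leibniz.

Lemma derivationZ a f : D (a *: f) = a *: D f.
Proof.
by case: hD => linD _; have := linD a f 0; rewrite (der0 hL) !addr0.
Qed.

Lemma derivation_const a : D a%:A = 0.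
Proof. by rewrite derivationZ (der1 hL) scaler0. Qed.

Lemma derivation_series g N :
  D (series (exp_term g) N.+1) = series (exp_term g) N * D g.
Proof.
rewrite /series /= big_nat_recl// (derD hL) (der_sum hL).
rewrite expr0 derivation_const add0r mulr_suml; apply: eq_bigr => k _.
rewrite derivationZ (der_exp hL) -!mulrA mulr_natl.
rewrite -[_ * _ *+ _](@scaler_nat R[i]) scalerA -scalerAl.
by rewrite factS natrM invfM mulrAC mulVf ?mul1r// pnatr_eq0.
Qed.

(** Termwise differentiation of the exponential series is justified by the
    continuity of [D]. *)
Lemma derivation_Exp0 g : g 1%N = 0 -> D (Exp0 g) = Exp0 g * D g.
Proof.
move=> g1; have cvg1 := cvg_comp _ _ (Exp0_cvg g1) (@cD (Exp0 g)).
apply: (cvg_unique arith_hausdorff cvg1).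
apply: arith_cvg => M; exists M.+1 => -[//|N] MN n nM /=.
rewrite derivation_series !amulE; case: n nM => [|n] nM.
  by rewrite !big1// => d _; rewrite div0n arith0 mulr0.
rewrite big_seq [RHS]big_seq; apply: eq_bigr => d.
rewrite -dvdn_divisors// => /(dvdn_leq (ltn0Sn n)) dn; congr (_ * _).
by rewrite (Exp0E g1 (N := N))//; apply: leq_ltn_trans dn _; apply: leq_trans nM _.
Qed.

Lemma derivation_Exp f : D (Exp f) = Exp f * D f.
Proof.
have g1 : (f - (f 1%N)%:A) 1%N = 0 by rewrite aaddE aoppE aconstE eqxx subrr.
rewrite /Exp mulr_algl derivationZ derivation_Exp0// (derB hL).
by rewrite derivation_const subr0 scalerAl.
Qed.

End Derivation.
End ArithmeticExponential.

Lemma frac_arith_pchar0 (R : realType) : [pchar {fraction (arith R)}] =i pred0.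
Proof.
apply/pcharf0P => n; rewrite -(rmorph_nat (@tofrac (arith R))) tofrac_eq0.
apply/eqP/eqP => [|->]; last by rewrite mulr0n.
move=> /(congr1 (fun h : arith R => h 1%N)).
have -> : (n%:R : arith R) 1%N = n%:R.
  by elim: n => [//|n IHn]; rewrite -!natr1 aaddE IHn.
by move/eqP; rewrite pnatr_eq0 => /eqP.
Qed.

(** * The transcendence degree bound *)

(** By the differential equation, the logarithmic derivative along [D] of a
    power product of the [y i] is the image under [D] of the corresponding
    integral combination of the [x i]. *)
Lemma rat_indep_mult_indep (F : fieldType) (Delta : set (F -> F)) (C : {pred F})
    n (x y : 'I_n -> F) :
    (forall D, Delta D -> leibniz D) ->
    (forall u, u \in C <-> forall D, Delta D -> D u = 0) ->
    (forall i, y i != 0) ->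
    (forall D i, Delta D -> D (y i) = y i * D (x i)) ->
  rat_indep_mod C x -> mult_indep_mod C y.
Proof.
move=> hDelta CP y0 Dy xind k p pC p0 i.
suff : \sum_i ratr (k i)%:~R * x i \in C.
  by move=> /xind/(_ i)/eqP; rewrite intr_eq0 => /eqP.
apply/CP => D DD; have hD := hDelta _ DD.
have Dp : D p = 0 by move/CP: pC; exact.
have : dlog D p = 0 by rewrite /dlog Dp mul0r.
rewrite /p dlog_prod// => [dp|j]; last by rewrite expfz_neq0.
rewrite -[RHS]dp (der_sum hD); apply: eq_bigr => j _.
rewrite ratr_int (derM hD) (der_int hD) mul0r add0r dlogXz// /dlog Dy//.
by rewrite [y j * _]mulrC mulfK.
Qed.

Theorem theorem3p1 (R : realType) (Delta : set (arith R -> arith R))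
    (hDelta : forall D, Delta D -> derivation D /\ continuous D)
    (n : nat) (f : 'I_n -> arith R) :
  let C : {pred {fraction (arith R)}} := kerF Delta in
  let x : 'I_n -> {fraction (arith R)} := fun i => (f i)%:F in
  let y : 'I_n -> {fraction (arith R)} := fun i => (Exp (f i))%:F in
  mult_indep_mod C y \/ rat_indep_mod C x ->
  ((n + rank_rows Delta (fun D i => (D (f i))%:F))%:R%:E
    <= trdeg R C (adjoin C [pred z | (z \in codom x) || (z \in codom y)]))%E.
Proof.
move=> C x y xy_indep.
pose Delta' := [set fder D | D in Delta].
have hDelta' D : Delta' D -> leibniz D.
  by move=> [D' /hDelta[hD' _] <-]; exact/leibniz_fder/derivation_leibniz.
have CP u : u \in C <-> forall D, Delta' D -> D u = 0.
  split=> [/asboolP uC _ [D DD <-]|uC]; first exact: uC.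
  by apply/asboolP => D DD; apply: uC; exists D.
have y0 i : y i != 0 by rewrite tofrac_eq0 Exp_neq0.
have fderE D : Delta D -> forall a, fder D a%:F = (D a)%:F.
  move=> /hDelta[/derivation_leibniz[DD DM] _]; exact: fder_tofrac.
have Dy D i : Delta' D -> D (y i) = y i * D (x i).
  move=> [D' DD <-]; rewrite !fderE// -tofracM; congr (_%:F).
  by have [hD cD] := hDelta _ DD; exact: derivation_Exp.
have yind : mult_indep_mod C y.
  case: xy_indep => // xind; exact: rat_indep_mult_indep hDelta' CP y0 Dy xind.
pose P (r : 'I_n.+1) := `[< exists t : 'I_r -> (arith R -> arith R),
  (forall j, Delta (t j)) /\ row_free (\matrix_(j < r, i < n) (t j (f i))%:F) >].
have [r /asboolP[t [Dt tfree]] rE] : exists2 r : 'I_n.+1, P r &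
    rank_rows Delta (fun D i => (D (f i))%:F) = r.
  have P0 : (0 < #|P|)%N.
    apply/card_gt0P; exists ord0; apply/asboolP.
    have t : 'I_(ord0 : 'I_n.+1) -> arith R -> arith R by case.
    by exists t; split=> [[]//|]; rewrite /row_free -leqn0 rank_leq_row.
  have [r rP rE] := eq_bigmax_cond (fun r : 'I_n.+1 => r : nat) P0.
  by exists r => //; rewrite -rE.
rewrite rE.
have Dt' j : Delta' (fder (t j)) by exists (t j).
have tfree' : row_free (\matrix_(j, i) fder (t j) (x i)).
  by move: tfree; congr row_free; apply/matrixP => j i; rewrite !mxE fderE.
have [z [zind zxy]] :=
  ax_schanuel (frac_arith_pchar0 R) hDelta' CP y0 Dy yind Dt' tfree'.
apply: ereal_sup_ubound; exists (n + r)%N => //=; exists z; split=> // k.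
apply/asboolP => L _ _; apply; rewrite inE.
by have [[i ->]|[i ->]] := zxy k; rewrite codom_f ?orbT.
Qed.
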